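(* Every convex body $K\subset\mathbb{R}^2$ satisfies $\mathrm{Sym}_{\mathrm{fold}}(K)\ge 3/8$. There is a sequence of parallelograms $P_j$ with $\mathrm{Sym}_{\mathrm{fold}}(P_j)\to 1/\phi$, where $\phi=\frac{1+\sqrt5}{2}$. Hence $3/8\le\varphi(2)\le 1/\phi$. Furthermore, every centrally symmetric convex body $K\subset\mathbb{R}^2$ satisfies $\mathrm{Sym}_{\mathrm{fold}}(K)\ge 4/9$, i.e. $\varphi_{cs}(2)\ge 4/9$.
   Context: A convex body is a compact convex set with nonempty interior. For a convex body $K\subset\mathbb{R}^n$, the folding symmetry is $$\mathrm{Sym}_{\mathrm{fold}}(K)=\frac{2}{\mathrm{vol}_n(K)}\sup\big\{\mathrm{vol}_n(K\cap\mathcal H):\ \mathcal H \text{ a closed halfspace with } \mathrm{refl}_{\partial\mathcal H}(K\cap\mathcal H)\subset K\big\},$$ where $\mathrm{refl}_{\partial\mathcal H}$ is the orthogonal reflection in the bounding hyperplane of $\mathcal H$. Define $\varphi(n)=\inf\{\mathrm{Sym}_{\mathrm{fold}}(K)\}$ over all convex bodies $K\subset\mathbb{R}^n$, and $\varphi_{cs}(n)$ the same infimum over centrally symmetric convex bodies only. *)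

(* Defs.v *)
From HB Require Import structures.
From mathcomp Require Import all_boot all_order all_algebra.
From mathcomp Require Import all_classical all_reals all_analysis.
Set Implicit Arguments. Unset Strict Implicit. Unset Printing Implicit Defensive.
Import Order.TTheory GRing.Theory Num.Theory.
Import numFieldNormedType.Exports.
Local Open Scope classical_set_scope.
Local Open Scope ring_scope.

Section Defs.
Variable R : realType.
Local Notation P2 := (R * R)%type.

Definition dot2 (a x : P2) : R := a.1 * x.1 + a.2 * x.2.

Definition convex2 (K : set P2) : Prop :=
  forall x y, K x -> K y -> forall t : R, 0 <= t -> t <= 1 ->
    K (t * x.1 + (1 - t) * y.1, t * x.2 + (1 - t) * y.2).

Definition convex_body2 (K : set P2) : Prop :=
  compact K /\ convex2 K /\ interior K !=set0.

Definition centrally_symmetric2 (K : set P2) : Prop :=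
  exists c : P2, forall x, K x -> K (2 * c.1 - x.1, 2 * c.2 - x.2).

Definition vol2 (A : set P2) : R :=
  fine ((@lebesgue_measure R \x @lebesgue_measure R)%E A).

Definition halfspace2 (a : P2) (c : R) : set P2 := [set x | dot2 a x <= c].

Definition refl2 (a : P2) (c : R) (x : P2) : P2 :=
  let k := 2 * (dot2 a x - c) / dot2 a a in (x.1 - k * a.1, x.2 - k * a.2).

Definition sym_fold2 (K : set P2) : R :=
  2 / vol2 K *
  sup [set r : R | exists (a : P2) (c : R), a != 0 /\
         refl2 a c @` (K `&` halfspace2 a c) `<=` K /\
         r = vol2 (K `&` halfspace2 a c)].

Definition is_parallelogram2 (P : set P2) : Prop :=
  exists o u v : P2, u.1 * v.2 - u.2 * v.1 != 0 /\
    P = [set (o.1 + s * u.1 + t * v.1, o.2 + s * u.2 + t * v.2)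
          | s in `[0, 1]%classic & t in `[0, 1]%classic].

Definition varphi2 : R := inf [set sym_fold2 K | K in convex_body2].
Definition varphi_cs2 : R :=
  inf [set sym_fold2 K | K in [set K | convex_body2 K /\ centrally_symmetric2 K]].

Definition golden : R := (1 + Num.sqrt 5) / 2.
End Defs.

(* Main.v *)
(** Lower bounds. Fix an area [al] and, among all pairs of parallel lines cutting off caps of
    area at least [al] on opposite sides of [K], take the pair at the largest distance [D].
    Both caps then have area exactly [al], and the midpoints of the two chords lie on a common
    perpendicular: otherwise tilting both lines about points close to the midpoints would
    preserve the areas and increase the distance to first order. So the chords span an
    isosceles trapezoid, and the cap behind the shorter chord folds into a rectangle of length
    [D] in [K], provided its depth is at most [D]. If some point [x] of a cap has depth
    [H > D], the homothety with centre [x] and ratio [H / (H + D)] maps the part of [K] up to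
    the second line into that cap, whence [vol K - al <= 4 al], which is false for
    [al = 3/16 vol K]. If [K] is centrally symmetric, the same argument up to the parallel
    through the centre gives [vol K / 2 < (3/2)^2 al], which is false for [al = 2/9 vol K].

    Upper bound. In the parallelogram with vertices [(0, 0), (1, 0), (s, e), (1 + s, e)], [e]
    small, a fold line is almost vertical, almost horizontal, or cuts off little area. An
    almost vertical one cuts off at most [(1 - s) / 2] of the area (attained by [x = 1/2]), an
    almost horizontal one about [1 / (2 (2 - s))]; the two agree at [s = (3 - sqrt 5) / 2],
    where [1 - s] is the inverse of the golden ratio. *)

Require Import Defs.
From HB Require Import structures.
From mathcomp Require Import all_boot all_order all_algebra.
From mathcomp Require Import all_classical all_reals all_analysis.
From mathcomp Require Import measurable_realfun ring lra.
Set Implicit Arguments.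
Unset Strict Implicit.
Unset Printing Implicit Defensive.
Import Order.TTheory GRing.Theory Num.Theory.
Import numFieldNormedType.Exports.
Local Open Scope classical_set_scope.
Local Open Scope ring_scope.

(** * Planar Lebesgue measure *)

Section Area.
Context {R : realType}.
Implicit Types (A B K : set (R * R)).

Local Notation leb := (@lebesgue_measure R).
Local Notation leb2 := (leb \x leb)%E.

(** An open set is the union of the boxes with rational corners that it contains. The other boxes
    are replaced by the empty set, so that the union runs over a countable type. *)
Lemma open_measurable2 (O : set (R * R)) : open O -> measurable O.
Proof.
move=> oO.
pose box (q : (rat * rat) * (rat * rat)) : set (R * R) :=
  `]ratr q.1.1, ratr q.1.2[ `*` `]ratr q.2.1, ratr q.2.2[.
have -> : O = \bigcup_q (if `[< box q `<=` O >] then box q else set0).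
  apply/seteqP; split => [[x y] Oxy|p [q _]]; last by case: ifPn => // /asboolP; exact.
  have [[U V] [/= Ux Vy] UVO] : nbhs (x, y) O by exact: open_nbhs_nbhs.
  have [e /= e0 eU] := Ux; have [d /= d0 dV] := Vy.
  have rat_in (a b : R) : a < b -> exists q : rat, a < ratr q < b.
    by move=> /rat_in_itvoo[q]; rewrite in_itv; exists q.
  have [q1 /andP[q11 q12]] := rat_in (x - e) x ltac:(lra).
  have [q2 /andP[q21 q22]] := rat_in x (x + e) ltac:(lra).
  have [q3 /andP[q31 q32]] := rat_in (y - d) y ltac:(lra).
  have [q4 /andP[q41 q42]] := rat_in y (y + d) ltac:(lra).
  exists ((q1, q2), (q3, q4)) => //.
  case: ifPn => [_|/asboolP[]].
    by split; rewrite /= in_itv /= ?q12 ?q21 ?q32 ?q41.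
  move=> [a b] [/=]; rewrite !in_itv /= => /andP[ha1 ha2] /andP[hb1 hb2].
  apply: UVO; split => /=.
    by apply: eU; rewrite /= ltr_norml; apply/andP; split; lra.
  by apply: dV; rewrite /= ltr_norml; apply/andP; split; lra.
apply: countable_bigcupT_measurable => [|q]; first exact: countableP.
by case: ifPn => _; [apply: measurableX; exact: measurable_itv|exact: measurable0].
Qed.

Lemma closed_measurable2 A : closed A -> measurable A.
Proof. by move/closed_openC/open_measurable2/measurableC; rewrite setCK. Qed.

Lemma compact_measurable2 A : compact A -> measurable A.
Proof.
by move=> /compact_closed cA; apply: closed_measurable2; apply: cA; exact: norm_hausdorff.
Qed.

Lemma continuous_dot2 (a : R * R) : continuous (dot2 a).
Proof.
move=> x; apply: cvgD; apply: cvgM; first exact: cvg_cst.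
- exact: cvg_fst.
- exact: cvg_cst.
- exact: cvg_snd.
Qed.

Lemma closed_le_fun (T : topologicalType) (f g : T -> R) :
  continuous f -> continuous g -> closed [set z | f z <= g z].
Proof.
move=> cf cg; rewrite (_ : mkset _ = (fun z => g z - f z) @^-1` [set r | 0 <= r]).
  by apply: closed_comp => [z _|]; [apply: cvgB; [exact: cg|exact: cf]|exact: closed_ge].
by apply/seteqP; split => z /=; rewrite subr_ge0.
Qed.

Lemma closed_halfspace2 a c : closed (halfspace2 a c : set (R * R)).
Proof. by apply: closed_le_fun; [exact: continuous_dot2|move=> z; exact: cvg_cst]. Qed.

Lemma measurable_halfspace2 a c : measurable (halfspace2 a c : set (R * R)).
Proof. by apply: closed_measurable2; exact: closed_halfspace2. Qed.

(** The pushforward under the affine map, scaled by [|l|], gives half-open intervals their length,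
    hence is Lebesgue measure by uniqueness. *)
Lemma leb_affine_preimage (l w : R) (A : set R) : l != 0 -> measurable A ->
  leb ((fun x => l * x + w) @^-1` A) = (`|l|^-1%:E * leb A)%E.
Proof.
move=> l0 mA.
pose f : measurableTypeR R -> measurableTypeR R := fun x => l * x + w.
have mf : measurable_fun setT f.
  by apply: measurable_funD => //; apply: measurable_funM.
have nl : (0 <= `|l|) by [].
pose mu := mscale (NngNum nl) (pushforward leb f).
have H : leb A = mu mf A.
  apply: lebesgue_measure_unique => //= _ [[a b]] _ <-.
  rewrite /mu /= /mscale /= /pushforward.
  (* The first case is [l < 0]: the preimage of []a, b]] is then closed on the left and open on the
     right, which does not affect its measure. *)
  have [l_gt0|l_lt0|/eqP] := ltgtP l 0; last by rewrite (negbTE l0).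
    have -> : f @^-1` `]a, b] = `[(b - w) / l, (a - w) / l[%classic.
      apply/seteqP; split => x /=; rewrite !in_itv /= /f => /andP[h1 h2];
        apply/andP; split.
      - by rewrite ler_ndivrMr //; lra.
      - by rewrite ltr_ndivlMr //; lra.
      - by move: h2; rewrite ltr_ndivlMr //; lra.
      - by move: h1; rewrite ler_ndivrMr //; lra.
    rewrite !lebesgue_measure_itv /= !lte_fin ltr_nM2r ?invr_lt0// ltrD2r.
    case: ifPn => _; last by rewrite mule0.
    by rewrite -!EFinD -EFinM ltr0_norm//; congr EFin; field.
  have -> : f @^-1` `]a, b] = `](a - w) / l, (b - w) / l]%classic.
    apply/seteqP; split => x /=; rewrite !in_itv /= /f => /andP[h1 h2];
      apply/andP; split.
    - by rewrite ltr_pdivrMr //; lra.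
    - by rewrite ler_pdivlMr //; lra.
    - by move: h1; rewrite ltr_pdivrMr //; lra.
    - by move: h2; rewrite ler_pdivlMr //; lra.
  rewrite !lebesgue_measure_itv /= !lte_fin ltr_pM2r ?invr_gt0// ltrD2r.
  case: ifPn => _; last by rewrite mule0.
  by rewrite -!EFinD -EFinM gtr0_norm//; congr EFin; field.
by rewrite H /mu /= /mscale /= /pushforward muleA -EFinM mulVf ?normr_eq0// mul1e.
Qed.

(** Here [w] is the translation part, not the centre: centre [z] corresponds to [w = (1 - l) z], and
    [l = -1], [w = 2 c] give the point reflection in [c]. *)
Definition homothety (l : R) (w x : R * R) : R * R := (l * x.1 + w.1, l * x.2 + w.2).

Lemma measurable_homothety l w : measurable_fun setT (homothety l w).
Proof.
by apply: measurable_fun_pair => /=; apply: measurable_funD => //;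
  apply: measurable_funM => //.
Qed.

(** As in dimension one, now by uniqueness of the product measure: on a rectangle each factor
    contributes [|l|^-1]. *)
Lemma leb2_homothety_preimage (l : R) (w : R * R) A : l != 0 -> measurable A ->
  leb2 (homothety l w @^-1` A) = ((l ^- 2)%:E * leb2 A)%E.
Proof.
move=> l0 mA.
pose f : measurableTypeR R * measurableTypeR R -> measurableTypeR R * measurableTypeR R
  := homothety l w.
have mf : measurable_fun setT f by exact: measurable_homothety.
have nl : (0 <= l ^+ 2) by exact: sqr_ge0.
pose mu := mscale (NngNum nl) (pushforward leb2 f).
have H : leb2 A = mu mf A.
  apply: product_measure_unique => //= B C mB mC.
  rewrite /mu /= /mscale /= /pushforward.
  have -> : f @^-1` (B `*` C) =
      ((fun x => l * x + w.1) @^-1` B) `*` ((fun x => l * x + w.2) @^-1` C) by [].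
  have mp (z : R) D : measurable D -> measurable ((fun x => l * x + z) @^-1` D).
    move=> mD; rewrite -[X in measurable X]setTI.
    suff /(_ measurableT D mD) : measurable_fun setT (fun x : R => l * x + z) by [].
    by apply: measurable_funD => //; apply: measurable_funM.
  rewrite product_measure1E; [|exact: mp|exact: mp].
  have E1 := leb_affine_preimage w.1 l0 mB.
  have E2 := leb_affine_preimage w.2 l0 mC.
  rewrite /= in E1 E2 *.
  rewrite E1 E2 muleACA.
  transitivity ((l ^+ 2 * (`|l|^-1 * `|l|^-1))%:E * (leb B * leb C))%E.
    by rewrite (EFinM (l ^+ 2)) (EFinM (`|l|^-1)) !muleA.
  by rewrite -invfM -normrM -expr2 ger0_norm// mulfV ?mul1e// sqrf_eq0.
by rewrite H /mu /= /mscale /= /pushforward muleA -EFinM mulVf ?mul1e// sqrf_eq0.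
Qed.

End Area.

(** * Areas of bounded sets and of trapezoids *)

Section Vol2.
Context {R : realType}.
Implicit Types (A B K : set (R * R)).

Local Notation leb := (@lebesgue_measure R).
Local Notation leb2 := (leb \x leb)%E.

Definition bounded2 A := exists M : R, forall x, A x -> `|x.1| <= M /\ `|x.2| <= M.

Lemma bounded2S A B : A `<=` B -> bounded2 B -> bounded2 A.
Proof. by move=> AB [M BM]; exists M => x /AB/BM. Qed.

Lemma compact_bounded2 A : compact A -> bounded2 A.
Proof.
move=> /compact_bounded[M [_ /(_ (M + 1))]].
rewrite ltrDl ltr01 => /(_ isT) AM; exists (M + 1) => x /AM /=.
by rewrite /Num.norm /= ge_max => /andP[].
Qed.

Lemma leb2_fin A : measurable A -> bounded2 A -> leb2 A \is a fin_num.
Proof.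
move=> mA [M AM]; rewrite ge0_fin_numE//.
have sub : A `<=` `[- M, M] `*` `[- M, M].
  move=> x /AM[]; rewrite !ler_norml => h1 h2.
  by split => /=; rewrite in_itv.
apply: (@le_lt_trans _ _ (leb2 (`[- M, M] `*` `[- M, M]))).
  by apply: le_measure => //; rewrite inE //; apply: measurableX; exact: measurable_itv.
rewrite product_measure1E; [|exact: measurable_itv|exact: measurable_itv].
by rewrite lte_mul_pinfty//= lebesgue_measure_itv /=; case: ifPn => // _; rewrite -EFinD ?ltry.
Qed.

Lemma vol2_ge0 A : 0 <= vol2 A.
Proof. exact: fine_ge0. Qed.

Lemma le_vol2 A B : measurable A -> measurable B -> bounded2 B -> A `<=` B ->
  vol2 A <= vol2 B.
Proof.
move=> mA mB bB AB; apply: fine_le.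
- by apply: leb2_fin => //; exact: bounded2S bB.
- exact: leb2_fin.
- by apply: le_measure => //; rewrite inE.
Qed.

Lemma vol2_split A H : measurable A -> bounded2 A -> measurable H ->
  vol2 A = vol2 (A `&` H) + vol2 (A `\` H).
Proof.
move=> mA bA mH; have mI := measurableI _ _ mA mH; have mD := measurableD mA mH.
have fI : leb2 (A `&` H) \is a fin_num.
  by apply: leb2_fin => //; apply: bounded2S bA; exact: subIsetl.
have fD : leb2 (A `\` H) \is a fin_num.
  by apply: leb2_fin => //; apply: bounded2S bA; exact: subDsetl.
rewrite /vol2 -fineD// -measureU//; first by rewrite setUIDK.
by rewrite setDE setIACA setICr setI0.
Qed.

Lemma vol2_homothety (l : R) (w : R * R) A : l != 0 -> measurable A ->
  vol2 (homothety l w @^-1` A) = l ^- 2 * vol2 A.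
Proof.
move=> l0 mA; rewrite /vol2 leb2_homothety_preimage//.
have h : 0 < (l ^- 2 : R) by rewrite invr_gt0 exprn_even_gt0.
have : (0 <= leb2 A)%E by [].
(* If the measure is infinite, [fine] turns both sides into [0]. *)
case: (leb2 A) => [r| |] //=; last by move=> _; rewrite gt0_muley ?lte_fin//= mulr0.
Qed.

Lemma measurable_homothety_preimage l w A : measurable A ->
  measurable (homothety l w @^-1` A).
Proof.
move=> mA; rewrite -[X in measurable X]setTI.
by have := measurable_homothety l w; apply.
Qed.

(** Cavalieri: the area is the integral of the lengths of the horizontal sections, and an affine
    length integrates to the height times the length at mid-height. *)
Lemma area_sections A (y0 y1 c0 c1 : R) : y0 < y1 -> measurable A ->
  (forall x, A x -> y0 <= x.2 <= y1) ->
  (forall y, y0 <= y <= y1 ->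
    leb (ysection A y) = (c0 + c1 * y)%:E) ->
  vol2 A = (y1 - y0) * (c0 + c1 * (y0 + y1) / 2).
Proof.
move=> y01 mA AY Al.
rewrite /vol2.
have -> : leb2 A = (leb \x^ leb)%E A.
  by apply: product_measure_unique => // B C mB mC; exact: product_measure2E.
pose F (y : R) := c0 * y + c1 / 2 * (y * y).
have dF (y : R) : is_derive y (1 : R) F (c0 + c1 * y).
  rewrite /F; apply: is_derive_eq.
  rewrite /GRing.scale /=.
  by field.
have cf : continuous (fun y : R => c0 + c1 * y).
  by move=> y; apply: cvgD; [exact: cvg_cst|apply: cvgM; [exact: cvg_cst|exact: cvg_id]].
have cF : continuous F.
  by move=> y; apply: differentiable_continuous; apply/derivable1_diffP; case: (dF y).
have -> : (leb \x^ leb)%E A = (\int[leb]_(y in `[y0, y1]) (c0 + c1 * y)%:E)%E.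
  rewrite integral_mkcond; apply: eq_integral => y _ /=.
  rewrite patchE; case: ifPn => [|]; first by rewrite inE /= in_itv /= => /Al.
  rewrite notin_setE /= in_itv /= => yn.
  have -> : ysection A y = set0; last by rewrite measure0.
  by rewrite -subset0 => x; rewrite /ysection /= inE => /AY.
rewrite (@continuous_FTC2 _ _ F)//.
- by rewrite -EFinD /= /F; field.
- by apply: continuous_subspaceT.
- split; first by move=> y _; case: (dF y).
  + by apply: cvg_at_right_filter; exact: cF.
  + by apply: cvg_at_left_filter; exact: cF.
- by move=> y _; rewrite derive1E; case: (dF y).
Qed.

(** The lateral sides give [x.1] as an affine function of [x.2], so that horizontal sections are
    intervals of affine length. Rectangles, triangles and parallelograms with horizontal sides are
    instances. *)
Definition trapezoid (y0 y1 a0 a1 b0 b1 : R) : set (R * R) :=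
  [set x | y0 <= x.2 <= y1 /\ a0 + a1 * x.2 <= x.1 <= b0 + b1 * x.2].

Lemma closed_trapezoid y0 y1 a0 a1 b0 b1 : closed (trapezoid y0 y1 a0 a1 b0 b1).
Proof.
have c1 : continuous (fst : R * R -> R) by move=> z; exact: cvg_fst.
have c2 : continuous (snd : R * R -> R) by move=> z; exact: cvg_snd.
have cc (r : R) : continuous (fun _ : R * R => r) by move=> z; exact: cvg_cst.
have ca (r t : R) : continuous (fun z : R * R => r + t * z.2).
  by move=> z; apply: cvgD; [exact: cvg_cst|apply: cvgM; [exact: cvg_cst|exact: cvg_snd]].
rewrite (_ : trapezoid _ _ _ _ _ _ =
    ([set z | y0 <= z.2] `&` [set z | z.2 <= y1]) `&`
    ([set z | a0 + a1 * z.2 <= z.1] `&` [set z | z.1 <= b0 + b1 * z.2])).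
  by apply: closedI; apply: closedI; exact: closed_le_fun.
apply/seteqP; split => z /=; first by case=> /andP[? ?] /andP[? ?].
by move=> [[h1 h2] [h3 h4]]; rewrite /trapezoid /= h1 h2 h3 h4.
Qed.

Lemma measurable_trapezoid y0 y1 a0 a1 b0 b1 :
  measurable (trapezoid y0 y1 a0 a1 b0 b1).
Proof. by apply: closed_measurable2; exact: closed_trapezoid. Qed.

Lemma bounded_trapezoid y0 y1 a0 a1 b0 b1 : bounded2 (trapezoid y0 y1 a0 a1 b0 b1).
Proof.
pose Y : R := `|y0| + `|y1|.
exists (Y + `|a0| + `|b0| + `|a1| * Y + `|b1| * Y) => -[x y] [/= /andP[h1 h2] /andP[h3 h4]].
have Y0 : 0 <= Y by rewrite addr_ge0.
have hy : `|y| <= Y.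
  rewrite ler_norml /Y; have := ler_norm (- y0); rewrite normrN.
  by have := ler_norm y1; have := normr_ge0 y0; have := normr_ge0 y1; lra.
have ha : `|a1 * y| <= `|a1| * Y by rewrite normrM ler_wpM2l.
have hb : `|b1 * y| <= `|b1| * Y by rewrite normrM ler_wpM2l.
have := ler_norm b0; have := ler_norm (- a0); rewrite normrN.
move: ha hb; have := normr_ge0 a0; have := normr_ge0 b0.
have : 0 <= `|a1| * Y by rewrite mulr_ge0.
have : 0 <= `|b1| * Y by rewrite mulr_ge0.
move=> p1 p2 p3 p4; rewrite !ler_norml => /andP[q1 q2] /andP[q3 q4] q5 q6.
by move: hy; rewrite ler_norml => /andP[q7 q8]; split; apply/andP; split; lra.
Qed.

Lemma vol2_trapezoid (y0 y1 a0 a1 b0 b1 : R) : y0 < y1 ->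
  a0 + a1 * y0 <= b0 + b1 * y0 -> a0 + a1 * y1 <= b0 + b1 * y1 ->
  vol2 (trapezoid y0 y1 a0 a1 b0 b1) =
  (y1 - y0) * ((b0 - a0) + (b1 - a1) * (y0 + y1) / 2).
Proof.
move=> y01 h0 h1; apply: area_sections => //; first exact: measurable_trapezoid.
  by move=> x [].
move=> y /andP[yy0 yy1].
have -> : ysection (trapezoid y0 y1 a0 a1 b0 b1) y =
    `[a0 + a1 * y, b0 + b1 * y]%classic.
  apply/seteqP; split => x; rewrite /ysection /= inE /trapezoid /= in_itv /=.
    by case.
  by move=> ->; rewrite yy0 yy1.
have h : a0 + a1 * y <= b0 + b1 * y by nra.
rewrite lebesgue_measure_itv /= lte_fin.
case: ifPn => [_|]; first by rewrite -EFinD; congr EFin; ring.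
by rewrite -leNgt => h'; congr EFin; lra.
Qed.

End Vol2.

(** * Areas cut off by half-planes *)

Section Caps.
Context {R : realType}.
Implicit Types (K : set (R * R)) (u : R * R).

Definition strip2 u (d e : R) : set (R * R) := [set x | d <= dot2 u x <= e].

Lemma closed_strip2 u d e : closed (strip2 u d e).
Proof.
rewrite (_ : strip2 _ _ _ = [set x | d <= dot2 u x] `&` [set x | dot2 u x <= e]).
  by apply: closedI; apply: closed_le_fun => //; try exact: continuous_dot2;
    move=> z; exact: cvg_cst.
by apply/seteqP; split => z /= => [/andP[? ?]//|[h1 h2]]; rewrite /strip2 /= h1 h2.
Qed.

Lemma measurable_strip2 u d e : measurable (strip2 u d e).
Proof. by apply: closed_measurable2; exact: closed_strip2. Qed.

(** Inside a box of half-width [M], the strip lies in a parallelogram of height [2 M] and horizontal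
    width [(e - d) / |u.1|], or, if [u.1 = 0], in a rectangle of width [2 M] and height
    [(e - d) / |u.2|]. *)
Lemma vol2_strip_le K u : measurable K -> bounded2 K -> u != 0 ->
  exists2 C : R, 0 <= C & forall d e, d < e ->
    vol2 (K `&` strip2 u d e) <= C * (e - d).
Proof.
move=> mK [M0 KM0] u0.
pose M : R := `|M0| + 1.
have M_gt0 : 0 < M by rewrite /M ltr_wpDl.
have KM x : K x -> [/\ - M <= x.1, x.1 <= M, - M <= x.2 & x.2 <= M].
  move=> /KM0[]; rewrite !ler_norml => /andP[h1 h2] /andP[h3 h4].
  have := ler_norm M0; rewrite /M => ?.
  by split; lra.
have [u10|u10] := eqVneq u.1 0.
  have u20 : u.2 != 0.
    by apply: contra_neq u0 => u20; rewrite (surjective_pairing u) u10 u20.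
  have main d e : d < e -> forall y0 y1 : R, y1 - y0 = (e - d) / `|u.2| ->
      (forall y, d <= u.2 * y <= e -> y0 <= y <= y1) ->
      vol2 (K `&` strip2 u d e) <= 2 * M / `|u.2| * (e - d).
    move=> de y0 y1 y01 hy.
    have y01' : y0 < y1 by rewrite -subr_gt0 y01 divr_gt0 ?subr_gt0// normr_gt0.
    have := @vol2_trapezoid R y0 y1 (- M) 0 M 0 y01' ltac:(lra) ltac:(lra).
    rewrite subr0 mul0r mul0r addr0 y01 => E.
    have -> : 2 * M / `|u.2| * (e - d) = (e - d) / `|u.2| * (M - - M) by ring.
    rewrite -E; apply: le_vol2.
    - by apply: measurableI => //; exact: measurable_strip2.
    - exact: measurable_trapezoid.
    - exact: bounded_trapezoid.
    - move=> x [/KM[h1 h2 h3 h4]]; rewrite /strip2 /= /dot2 u10 mul0r add0r => /hy ?.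
      by split => //; apply/andP; split; lra.
  exists (2 * M / `|u.2|) => [|d e de].
    by rewrite divr_ge0// mulr_ge0// ltW.
  case: (ltgtP u.2 0) => [un|up|]; last by move/eqP; rewrite (negbTE u20).
    apply: (main _ _ de (e / u.2) (d / u.2)).
      by rewrite (ltr0_norm un) invrN; ring.
    by move=> y /andP[h1 h2]; rewrite ler_ndivrMr// ler_ndivlMr// ![y * _]mulrC h1 h2.
  apply: (main _ _ de (d / u.2) (e / u.2)).
    by rewrite (gtr0_norm up); ring.
  by move=> y /andP[h1 h2]; rewrite ler_pdivrMr// ler_pdivlMr// ![y * _]mulrC h1 h2.
have main d e : d < e -> forall a b : R, b - a = (e - d) / `|u.1| ->
    (forall x y, d <= u.1 * x + u.2 * y <= e ->
      a - u.2 / u.1 * y <= x <= b - u.2 / u.1 * y) ->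
    vol2 (K `&` strip2 u d e) <= 2 * M / `|u.1| * (e - d).
  move=> de a b ab hx.
  have ab' : a < b by rewrite -subr_gt0 ab divr_gt0 ?subr_gt0// normr_gt0.
  have := @vol2_trapezoid R (- M) M a (- (u.2 / u.1)) b (- (u.2 / u.1))
    ltac:(lra) ltac:(lra) ltac:(lra).
  rewrite ab subrr !mul0r addr0 => E.
  have -> : 2 * M / `|u.1| * (e - d) = (M - - M) * ((e - d) / `|u.1|) by ring.
  rewrite -E; apply: le_vol2.
  - by apply: measurableI => //; exact: measurable_strip2.
  - exact: measurable_trapezoid.
  - exact: bounded_trapezoid.
  - move=> x [/KM[h1 h2 h3 h4]]; rewrite /strip2 /= /dot2 => /hx /andP[? ?].
    by split; apply/andP; split; lra.
exists (2 * M / `|u.1|) => [|d e de].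
  by rewrite divr_ge0// mulr_ge0// ltW.
case: (ltgtP u.1 0) => [un|up|]; last by move/eqP; rewrite (negbTE u10).
  apply: (main _ _ de (e / u.1) (d / u.1)).
    by rewrite (ltr0_norm un) invrN; ring.
  move=> x y /andP[h1 h2].
  rewrite [u.2 / _]mulrC -mulrA [u.1^-1 * _]mulrC -!mulrBl ler_ndivrMr// ler_ndivlMr//.
  by apply/andP; split; lra.
apply: (main _ _ de (d / u.1) (e / u.1)).
  by rewrite (gtr0_norm up); ring.
move=> x y /andP[h1 h2].
rewrite [u.2 / _]mulrC -mulrA [u.1^-1 * _]mulrC -!mulrBl ler_pdivrMr// ler_pdivlMr//.
by apply/andP; split; lra.
Qed.

Definition cap K u d : R := vol2 (K `&` halfspace2 u d).

Lemma cap_mono K u d e : measurable K -> bounded2 K -> d <= e ->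
  cap K u d <= cap K u e.
Proof.
move=> mK bK de; apply: le_vol2.
- by apply: measurableI => //; exact: measurable_halfspace2.
- by apply: measurableI => //; exact: measurable_halfspace2.
- by apply: bounded2S bK; exact: subIsetl.
- by move=> x [Kx xd]; split => //; exact: le_trans xd de.
Qed.

Lemma cap_le_vol2 K u d : measurable K -> bounded2 K -> cap K u d <= vol2 K.
Proof.
move=> mK bK; apply: le_vol2 => //.
by apply: measurableI => //; exact: measurable_halfspace2.
Qed.

Lemma cap_lipschitz K u : measurable K -> bounded2 K -> u != 0 ->
  exists2 C : R, 0 <= C & forall d e, d < e -> cap K u e <= cap K u d + C * (e - d).
Proof.
move=> mK bK u0; have [C C0 CP] := vol2_strip_le mK bK u0.
exists C => // d e de; rewrite /cap.
have mKe : measurable (K `&` halfspace2 u e).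
  by apply: measurableI => //; exact: measurable_halfspace2.
have bKe : bounded2 (K `&` halfspace2 u e) by apply: bounded2S bK; exact: subIsetl.
rewrite (vol2_split mKe bKe (measurable_halfspace2 u d)); apply: lerD.
  apply: le_vol2.
  - by apply: measurableI => //; exact: measurable_halfspace2.
  - by apply: measurableI => //; exact: measurable_halfspace2.
  - by apply: bounded2S bK; exact: subIsetl.
  - by move=> x [[? ?] ?].
apply: le_trans (CP _ _ de); apply: le_vol2.
- by apply: measurableD => //; exact: measurable_halfspace2.
- by apply: measurableI => //; exact: measurable_strip2.
- by apply: bounded2S bK; exact: subIsetl.
- move=> x [[Kx xe] /negP]; rewrite -ltNge => dx; split => //.
  by rewrite /strip2 /= (ltW dx).
Qed.

Lemma vol2_line0 K u d : measurable K -> bounded2 K -> u != 0 ->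
  vol2 (K `&` [set x | dot2 u x = d]) = 0.
Proof.
move=> mK bK u0; have [C C0 CP] := vol2_strip_le mK bK u0.
have El : [set x | dot2 u x = d] = strip2 u d d.
  apply/seteqP; split => x; rewrite /strip2 /=; first by move=> ->; rewrite lexx.
  by rewrite -eq_le => /eqP.
apply/eqP; rewrite eq_le vol2_ge0 andbT El; apply/ler_addgt0Pr => e e0.
(* The divisor is [C + 1] because [C] may be [0]. *)
rewrite add0r; have C1 : 0 < C + 1 by rewrite ltr_wpDl.
apply: (@le_trans _ _ (C * (d + e / (C + 1) - d))).
  apply: le_trans (CP _ _ _); last by rewrite ltrDl divr_gt0.
  apply: le_vol2.
  - by apply: measurableI => //; exact: measurable_strip2.
  - by apply: measurableI => //; exact: measurable_strip2.
  - by apply: bounded2S bK; exact: subIsetl.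
  - move=> x [Kx /andP[h1 h2]]; split => //; rewrite /strip2 /= h1 /=.
    by apply: le_trans h2 _; rewrite lerDl divr_ge0// ltW.
rewrite addrC addKr mulrA ler_pdivrMr//; nra.
Qed.

Lemma measurable_line u d : measurable [set x : R * R | dot2 u x = d].
Proof.
rewrite (_ : mkset _ = strip2 u d d); first exact: measurable_strip2.
apply/seteqP; split => x; rewrite /strip2 /=; first by move=> ->; rewrite lexx.
by rewrite -eq_le => /eqP.
Qed.

Lemma dot2N u x : dot2 (- u) x = - dot2 u x.
Proof. by rewrite /dot2 /=; ring. Qed.

(** The opposite half-plane of the same line is [halfspace2 (- u) (- d)]; the two closed half-planes
    overlap only in the line, a null set. *)
Lemma cap_opp K u d : measurable K -> bounded2 K -> u != 0 ->
  cap K u d + cap K (- u) (- d) = vol2 K.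
Proof.
move=> mK bK u0; rewrite (vol2_split mK bK (measurable_halfspace2 u d)).
congr (_ + _); rewrite /cap.
have mKN : measurable (K `&` halfspace2 (- u) (- d)).
  by apply: measurableI => //; exact: measurable_halfspace2.
have bKN : bounded2 (K `&` halfspace2 (- u) (- d)) by apply: bounded2S bK; exact: subIsetl.
rewrite (vol2_split mKN bKN (measurable_line u d)).
rewrite (_ : _ `&` _ `&` _ = K `&` [set x | dot2 u x = d]); last first.
  apply/seteqP; split => x; first by move=> [[? ?] ?].
  by move=> [Kx] /= xd; split => //; split => //; rewrite /halfspace2 /= dot2N xd.
rewrite vol2_line0// add0r; congr vol2; apply/seteqP; split => x.
  move=> [[Kx]]; rewrite /halfspace2 /= dot2N lerN2 => xd xnd; split => //.
  by apply/negP; rewrite -ltNge lt_neqAle xd andbT eq_sym; exact/eqP.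
move=> [Kx /negP]; rewrite -ltNge => dx; split.
  by split => //; rewrite /halfspace2 /= dot2N lerN2 ltW.
by move=> /= xd; rewrite xd ltxx in dx.
Qed.

Lemma vol2_gt0 K : measurable K -> bounded2 K -> interior K !=set0 -> 0 < vol2 K.
Proof.
move=> mK bK [[a b]] [[U V] [/= Ua Vb] UVK].
have [e /= e0 eU] := Ua; have [d /= d0 dV] := Vb.
have h := @vol2_trapezoid R (b - d / 2) (b + d / 2) (a - e / 2) 0 (a + e / 2) 0
  ltac:(lra) ltac:(lra) ltac:(lra).
apply: (@lt_le_trans _ _ (vol2 (trapezoid (b - d / 2) (b + d / 2) (a - e / 2) 0 (a + e / 2) 0))).
  rewrite h subr0 !mul0r addr0; apply: mulr_gt0; lra.
apply: le_vol2 => //; first exact: measurable_trapezoid.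
move=> [x y] [/= /andP[? ?] /andP[? ?]]; apply: UVK; split => /=.
  by apply: eU; rewrite /= ltr_norml; apply/andP; split; lra.
by apply: dV; rewrite /= ltr_norml; apply/andP; split; lra.
Qed.

End Caps.

(** * Convex sets in rotated coordinates *)

Section Frames.
Context {R : realType}.
Implicit Types (K : set (R * R)) (u v : R * R).

Definition orthonormal u v := [/\ dot2 u u = 1, dot2 v v = 1 & dot2 u v = 0].

Definition frame u v (s t : R) : R * R := (s * u.1 + t * v.1, s * u.2 + t * v.2).

Lemma dot2_frame_l u v s t : orthonormal u v -> dot2 u (frame u v s t) = s.
Proof.
move=> [uu _ uv]; have -> : dot2 u (frame u v s t) = s * dot2 u u + t * dot2 u v.
  by rewrite /dot2 /frame /=; ring.
by rewrite uu uv mulr1 mulr0 addr0.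
Qed.

Lemma dot2_frame_r u v s t : orthonormal u v -> dot2 v (frame u v s t) = t.
Proof.
move=> [_ vv uv]; have -> : dot2 v (frame u v s t) = s * dot2 u v + t * dot2 v v.
  by rewrite /dot2 /frame /=; ring.
by rewrite vv uv mulr1 mulr0 add0r.
Qed.

(** With [D] the determinant, [u] is [D] times [v] turned by a right angle, and [D * D = 1]. Hence
    the matrix with columns [u] and [v] also has orthonormal rows, which is what [e1], [e2] and [e3]
    say. *)
Lemma frame_dot2 u v x : orthonormal u v -> frame u v (dot2 u x) (dot2 v x) = x.
Proof.
case: u => u1 u2; case: v => v1 v2; case: x => x1 x2.
rewrite /orthonormal /frame /dot2 /= => -[uu vv uv].
pose D := u1 * v2 - u2 * v1.
have lc (p q r : R) : q = r -> p * q = p * r by move=> ->.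
have hu1 : u1 = D * v2.
  by rewrite /D; have := lc u1 _ _ vv; have := lc v1 _ _ uv; lra.
have hu2 : u2 = - D * v1.
  by rewrite /D; have := lc u2 _ _ vv; have := lc v2 _ _ uv; lra.
have DD : D * D = 1.
  have : (u1 * u1 + u2 * u2) * (v1 * v1 + v2 * v2) =
    D * D + (u1 * v1 + u2 * v2) * (u1 * v1 + u2 * v2) by rewrite /D; ring.
  by rewrite uu vv uv mulr0 addr0 mulr1 => <-.
have hD (p q : R) : D * p * (D * q) = p * q by rewrite mulrACA DD mul1r.
have e1 : u1 * u1 + v1 * v1 = 1 by rewrite hu1 hD; lra.
have e2 : u2 * u2 + v2 * v2 = 1 by rewrite hu2 !mulNr mulrN opprK hD; lra.
have e3 : u1 * u2 + v1 * v2 = 0 by rewrite hu1 hu2 mulNr mulrN hD; lra.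
congr pair.
  by have := lc x1 _ _ e1; have := lc x2 _ _ e3; lra.
by have := lc x2 _ _ e2; have := lc x1 _ _ e3; lra.
Qed.

Lemma orthonormal_opp u v : orthonormal u v -> orthonormal (- u) (- v).
Proof.
move=> [uu vv uv]; split.
- by rewrite -uu /dot2 /=; ring.
- by rewrite -vv /dot2 /=; ring.
- by rewrite -uv /dot2 /=; ring.
Qed.

Lemma orthonormal_oppr u v : orthonormal u v -> orthonormal u (- v).
Proof.
move=> [uu vv uv]; split => //.
- by rewrite -vv /dot2 /=; ring.
- by rewrite -[RHS]oppr0 -uv /dot2 /=; ring.
Qed.

Lemma frame_opp u v s t : frame (- u) (- v) s t = frame u v (- s) (- t).
Proof. by rewrite /frame /=; congr pair; ring. Qed.

Lemma frame_oppr u v s t : frame u (- v) s t = frame u v s (- t).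
Proof. by rewrite /frame /=; congr pair; ring. Qed.

Lemma orthonormal_neq0 u v : orthonormal u v -> u != 0.
Proof.
move=> [uu _ _]; apply/eqP => u0; move: uu; rewrite u0 /dot2 /= !mul0r addr0.
by move/eqP; rewrite eq_sym oner_eq0.
Qed.

Definition convexr (k : R -> R -> Prop) := forall s t s' t' l : R,
  k s t -> k s' t' -> 0 <= l <= 1 -> k (l * s + (1 - l) * s') (l * t + (1 - l) * t').

Lemma convexr_frame K u v : convex2 K -> convexr (fun s t => K (frame u v s t)).
Proof.
move=> cK s t s' t' l h1 h2 /andP[l0 l1].
have := cK _ _ h1 h2 l l0 l1; rewrite /frame /=.
by congr (K (_, _)); ring.
Qed.

(* The region lost when a line through the pivot [0] is tilted by [tau] is reflected in the
   pivot into the region gained, if the pivot is closer to the end [- phi] of the chord on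
   the losing side than to the end [gam]. *)
Lemma wedge_reflection (k : R -> R -> Prop) (phi gam z w B : R) : convexr k ->
  0 <= phi -> phi < gam -> 0 < z -> 0 <= B ->
  k 0 0 -> k 0 gam -> (forall b, k 0 b -> - phi <= b) -> k z w ->
  (forall a b, k a b -> `|b| <= B) ->
  exists2 tau0, 0 < tau0 & forall tau, 0 < tau < tau0 -> forall a b,
    0 < a -> a < tau * b -> k (- a) (- b) -> k a b.
Proof.
move=> ck phi0 phigam z0 B0 k00 k0g kphi kz kB.
have W0 := normr_ge0 w.
(* The first bound makes [b z - a w] positive. The second turns the slack [gam - phi] into
   [phi (z + a) <= gam (z - a)]. *)
exists (Num.min (z / (`|w| + 1)) ((gam - phi) * z / ((B + 1) * (gam + phi)))).
  by rewrite lt_min !divr_gt0// ?mulr_gt0//; lra.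
move=> tau /andP[tau0]; rewrite lt_min ltr_pdivlMr; last lra.
rewrite ltr_pdivlMr; last by rewrite mulr_gt0//; lra.
move=> /andP[t1 t2] a b a0 atb kab.
have b0 : 0 < b by rewrite -(pmulr_rgt0 _ tau0); lra.
have bB : b <= B by have := kB _ _ kab; rewrite normrN ger0_norm// ltW.
have za0 : 0 < z + a by lra.
(* The segment from [(- a, - b)] to [(z, w)] meets the chord at height at least [- phi]. *)
have cross : b * z - a * w <= phi * (z + a).
  have l01 : 0 <= z / (z + a) <= 1.
    by rewrite divr_ge0 ?ler_pdivrMr//=; lra.
  have := ck _ _ _ _ (z / (z + a)) kab kz l01.
  have -> : z / (z + a) * - a + (1 - z / (z + a)) * z = 0 by field; lra.
  move=> /kphi.
  have -> : z / (z + a) * - b + (1 - z / (z + a)) * w = (a * w - b * z) / (z + a).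
    by field; lra.
  by rewrite ler_pdivlMr//; lra.
have aw : a * `|w| < b * z.
  have : tau * b * `|w| <= b * (tau * (`|w| + 1)) by nra.
  nra.
have awp : - (a * `|w|) <= a * w <= a * `|w|.
  by rewrite -mulrN !ler_pM2l// ler_norm andbT lerNl -normrN ler_norm.
have c1 : 0 < b * z - a * w by lra.
have ag : a * (gam + phi) <= (gam - phi) * z.
  have : a * (gam + phi) <= tau * b * (gam + phi) by rewrite ler_pM2r; lra.
  have : tau * b * (gam + phi) <= tau * ((B + 1) * (gam + phi)).
    by rewrite -mulrA ler_pM2l// ler_pM2r; lra.
  lra.
have c2 : b * z - a * w <= gam * (z - a) by nra.
have gam0 : 0 < gam by lra.
have az : a < z by rewrite -subr_gt0 -(pmulr_rgt0 _ gam0); lra.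
(* The line through [(z, w)] and [(a, b)] meets the axis of the chord at this height, which lies
   between [0] and [gam]. So [(a, b)] is between a point of the chord and [(z, w)]. *)
have kP : k 0 ((b * z - a * w) / (z - a)).
  have := ck _ _ _ _ ((b * z - a * w) / (z - a) / gam) k0g k00.
  rewrite !mulr0 !addr0 divfK; last lra.
  apply; rewrite !divr_ge0//=; [|lra..].
  by rewrite ler_pdivrMr ?ler_pdivrMr; lra.
have := ck _ _ _ _ (a / z) kz kP.
have -> : a / z * z + (1 - a / z) * 0 = a by field; lra.
have -> : a / z * w + (1 - a / z) * ((b * z - a * w) / (z - a)) = b by field; lra.
by apply; rewrite divr_ge0 ?ler_pdivrMr//; lra.
Qed.

End Frames.

(** * Tilting, folding and scaling of caps *)

Section Moves.
Context {R : realType}.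
Implicit Types (K : set (R * R)) (u v : R * R).

(** The right-hand side is the area of the open cap. Tilting uses this form, since
    [wedge_reflection] asks for points strictly on one side of the line. *)
Lemma cap_strict K u d : measurable K -> bounded2 K -> u != 0 ->
  cap K u d = vol2 (K `\` halfspace2 (- u) (- d)).
Proof.
move=> mK bK u0; apply: (@addIr _ (cap K (- u) (- d))).
rewrite cap_opp// addrC (vol2_split mK bK (measurable_halfspace2 (- u) (- d))).
by [].
Qed.

Lemma halfspace2_oppE u d x : halfspace2 (- u) (- d) x <-> d <= dot2 u x.
Proof. by rewrite /halfspace2 /= dot2N lerN2. Qed.

Lemma bounded2_frame K u v : bounded2 K -> exists2 B : R, 0 <= B &
  forall s t, K (frame u v s t) -> `|dot2 v (frame u v s t)| <= B.
Proof.
move=> [M KM]; exists (`|M| * (`|v.1| + `|v.2|)); first by rewrite mulr_ge0// addr_ge0.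
move=> s t /KM [h1 h2]; rewrite /dot2; apply: le_trans (ler_normD _ _) _.
rewrite !normrM mulrDr; have MM := ler_norm M.
by rewrite ![`|M| * _]mulrC; apply: lerD; apply: ler_wpM2l => //; apply: le_trans MM.
Qed.

(** The tilted line still passes through the pivot [frame u v d nu]. By [wedge_reflection], in
    coordinates centred at the pivot, the point reflection in the pivot carries the lost part of the
    cap into the gained part. *)
Lemma cap_tilt K u v (d nu f g z w : R) : measurable K -> bounded2 K -> convex2 K ->
  orthonormal u v ->
  K (frame u v d nu) -> K (frame u v d g) ->
  (forall t, K (frame u v d t) -> f <= t) ->
  K (frame u v z w) -> d < z -> nu - f < g - nu ->
  exists2 tau0 : R, 0 < tau0 & forall tau, 0 < tau < tau0 ->
    cap K u d <= cap K (u - (tau * v.1, tau * v.2)) (d - tau * nu).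
Proof.
move=> mK bK cK uv kN kg kf kz dz fg.
have u0 := orthonormal_neq0 uv.
have [B B0 KB] := bounded2_frame u v bK.
pose k (a b : R) := K (frame u v (d + a) (nu + b)).
have ck : convexr k.
  move=> s t s' t' l h1 h2 hl.
  have := @convexr_frame R K u v cK _ _ _ _ _ h1 h2 hl; rewrite /k.
  by congr (K (frame u v _ _)); ring.
have kB a b : k a b -> `|b| <= B + `|nu|.
  move=> kab; have := KB _ _ kab; rewrite dot2_frame_r// => h.
  have -> : b = (nu + b) - nu by ring.
  by apply: le_trans (ler_normB _ _) _; rewrite lerD2r.
have B0' : 0 <= B + `|nu| by rewrite addr_ge0.
have k00 : k 0 0 by rewrite /k !addr0.
have k0g : k 0 (g - nu) by rewrite /k addr0 addrC subrK.
have phi0 : 0 <= nu - f by rewrite subr_ge0; exact: kf.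
have kphi b : k 0 b -> - (nu - f) <= b.
  by rewrite /k addr0 => /kf; lra.
have kzw : k (z - d) (w - nu).
  by rewrite /k ![_ + (_ - _)]addrC !subrK.
have dz0 : 0 < z - d by lra.
have [tau0 tau0_gt0 H] := wedge_reflection ck phi0 fg dz0 B0' k00 k0g kphi kzw kB.
exists tau0 => // tau taub.
set u' := u - _; set d' := d - _.
have du' s t : dot2 u' (frame u v s t) = s - tau * t.
  have -> : dot2 u' (frame u v s t) =
      dot2 u (frame u v s t) - tau * dot2 v (frame u v s t).
    by rewrite /dot2 /u' /=; ring.
  by rewrite dot2_frame_l// dot2_frame_r.
rewrite cap_strict// /cap; set C := K `\` _; set T := K `&` _.
pose S := ~` (halfspace2 (- u) (- d) : set (R * R)).
have mC : measurable C by apply: measurableD => //; exact: measurable_halfspace2.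
have mT : measurable T by apply: measurableI => //; exact: measurable_halfspace2.
have mS : measurable S by apply: measurableC; exact: measurable_halfspace2.
have bC : bounded2 C by apply: bounded2S bK; exact: subDsetl.
have bT : bounded2 T by apply: bounded2S bK; exact: subIsetl.
(* The old and the new cap share [C] cut by the new half-plane; what remains is to compare the lost
   part with the gained part. *)
rewrite (vol2_split mC bC (measurable_halfspace2 u' d')) (vol2_split mT bT mS).
rewrite (_ : T `&` S = C `&` halfspace2 u' d'); last first.
  by rewrite /T /S /C setDE setIAC.
rewrite lerD2l.
have mTS : measurable (T `\` S) by exact: measurableD.
have := @vol2_homothety R (-1) (2 * (frame u v d nu).1, 2 * (frame u v d nu).2) (T `\` S).
rewrite oppr_eq0 oner_eq0 sqrrN expr1n invr1 mul1r => /(_ isT mTS) <-.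
apply: le_vol2.
- by apply: measurableD => //; exact: measurable_halfspace2.
- exact: measurable_homothety_preimage.
- have [M TM] := bT; exists (M + 2 * (`|(frame u v d nu).1| + `|(frame u v d nu).2|)).
  have h1 := normr_ge0 (frame u v d nu).1; have h2 := normr_ge0 (frame u v d nu).2.
  move=> x [/TM[]]; rewrite /homothety /= => e1 e2 _.
  split.
    have -> : x.1 = 2 * (frame u v d nu).1 - (-1 * x.1 + 2 * (frame u v d nu).1) by ring.
    by apply: le_trans (ler_normB _ _) _; rewrite normrM ger0_norm//; lra.
  have -> : x.2 = 2 * (frame u v d nu).2 - (-1 * x.2 + 2 * (frame u v d nu).2) by ring.
  by apply: le_trans (ler_normB _ _) _; rewrite normrM ger0_norm//; lra.
- move=> x [[Kx /halfspace2_oppE/negP]]; rewrite -ltNge => xd /negP; rewrite -ltNge => xu'.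
  set s := dot2 u x in xd; pose t := dot2 v x.
  have xE : x = frame u v s t by rewrite frame_dot2.
  rewrite xE du' /d' in xu'.
  have hx : homothety (-1) (2 * (frame u v d nu).1, 2 * (frame u v d nu).2) x =
      frame u v (d + (d - s)) (nu + (nu - t)).
    by rewrite xE /homothety /frame /=; congr pair; ring.
  rewrite /= hx; split; first split.
  + apply: (H _ taub); [lra|lra|].
    by rewrite /k !opprB !(addrC _ (_ - _)) !subrK -xE.
  + by rewrite /halfspace2 /= du' /d'; lra.
  + move=> /=; apply; apply/halfspace2_oppE; rewrite dot2_frame_l//; lra.
Qed.

Definition is_fold K u (c : R) := refl2 u c @` (K `&` halfspace2 u c) `<=` K.

(** A point of the cap outside the band of the shorter chord, joined to an end of the longer one,
    would cross level [d1] outside the shorter chord. So the cap lies in the band, and the part of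
    the band between the two levels lies in [K]. *)
Lemma is_fold_chords K u v (d1 d2 f g f' g' : R) : convex2 K -> orthonormal u v -> d1 < d2 ->
  K (frame u v d1 f) -> K (frame u v d1 g) ->
  (forall t, K (frame u v d1 t) -> f <= t <= g) ->
  K (frame u v d2 f') -> K (frame u v d2 g') -> f' <= f -> g <= g' ->
  (forall x, K x -> d1 - dot2 u x <= d2 - d1) ->
  is_fold K u d1.
Proof.
move=> cK uv d12 kf kg chord kf' kg' ff gg depth _ [x [Kx xd] <-].
have ck := @convexr_frame R K u v cK.
pose s := dot2 u x; pose t := dot2 v x.
have xE : x = frame u v s t by rewrite frame_dot2.
have sd : s <= d1 by [].
have kst : K (frame u v s t) by rewrite -xE.
have -> : refl2 u d1 x = frame u v (2 * d1 - s) t.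
  rewrite /refl2; case: uv (uv) => -> _ _ uv; rewrite divr1 -/s {1 2}xE /frame /=.
  by congr pair; ring.
have fg : f <= g by have /andP[] := chord _ kf.
have ds : 0 < d2 - s by lra.
(* Weight at which the segment from level [s] to level [d2] crosses level [d1]. *)
pose l := (d2 - d1) / (d2 - s).
have l0 : 0 < l by rewrite divr_gt0//; lra.
have l1 : l <= 1 by rewrite ler_pdivrMr//; lra.
have l01 : 0 <= l <= 1 by rewrite ltW.
have ld : l * s + (1 - l) * d2 = d1 by rewrite /l; field; lra.
have tg : t <= g.
  have := ck _ _ _ _ _ kst kg' l01; rewrite ld => /chord/andP[_ h].
  by rewrite -(ler_pM2l l0); nra.
have tf : f <= t.
  have := ck _ _ _ _ _ kst kf' l01; rewrite ld => /chord/andP[h _].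
  by rewrite -(ler_pM2l l0); nra.
have between (d a b c : R) : K (frame u v d a) -> K (frame u v d b) -> a <= c <= b ->
    K (frame u v d c).
  move=> ka kb /andP[ac cb]; have [ab|ab] := eqVneq a b.
    by rewrite (_ : c = a)//; lra.
  have ba : 0 < b - a by rewrite subr_gt0 lt_neqAle ab; lra.
  have := ck _ _ _ _ ((b - c) / (b - a)) ka kb.
  have -> : (b - c) / (b - a) * d + (1 - (b - c) / (b - a)) * d = d by ring.
  have -> : (b - c) / (b - a) * a + (1 - (b - c) / (b - a)) * b = c by field; lra.
  apply; rewrite divr_ge0/= ?ler_pdivrMr//; lra.
have k1 : K (frame u v d1 t) by apply: (between _ f g) => //; rewrite tf tg.
have k2 : K (frame u v d2 t).
  by apply: (between _ f' g') => //; rewrite (le_trans ff)//= (le_trans tg).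
(* The image [(2 * d1 - s, t)] is the combination with weight [m] of [(d1, t)] and [(d2, t)]; the
   bound on the depth gives [0 <= m]. *)
pose m := (d2 - (2 * d1 - s)) / (d2 - d1).
have := ck _ _ _ _ m k1 k2.
have -> : m * d1 + (1 - m) * d2 = 2 * d1 - s by rewrite /m; field; lra.
have -> : m * t + (1 - m) * t = t by ring.
have dx := depth _ Kx; rewrite -/s in dx.
by apply; rewrite /m divr_ge0/= ?ler_pdivrMr; lra.
Qed.

(** The homothety with centre [x] that takes level [e] to level [d] maps [K] into itself by
    convexity, hence the larger cap into the smaller one. *)
Lemma cap_homothety_le K u (d e : R) x : measurable K -> bounded2 K -> convex2 K ->
  K x -> dot2 u x < d -> d <= e ->
  cap K u e <= ((e - dot2 u x) / (d - dot2 u x)) ^+ 2 * cap K u d.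
Proof.
move=> mK bK cK Kx xd de; set a := dot2 u x in xd *.
have h1 : 0 < d - a by lra.
have h2 : 0 < e - a by lra.
pose r := (d - a) / (e - a).
have r0 : 0 < r by rewrite divr_gt0.
have r1 : r <= 1 by rewrite ler_pdivrMr//; lra.
have mKd : measurable (K `&` halfspace2 u d).
  by apply: measurableI => //; exact: measurable_halfspace2.
have := @vol2_homothety R r ((1 - r) * x.1, (1 - r) * x.2) (K `&` halfspace2 u d).
rewrite gt_eqF// => /(_ isT mKd).
have -> : r ^- 2 = ((e - a) / (d - a)) ^+ 2 by rewrite -exprVn /r invf_div.
move=> <-; apply: le_vol2.
- by apply: measurableI => //; exact: measurable_halfspace2.
- exact: measurable_homothety_preimage.
- have [M KM] := bK.
  pose P := `|(1 - r) * x.1| + `|(1 - r) * x.2|.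
  exists ((M + P) / r) => y [/KM[]]; rewrite /homothety /= => e1 e2 _.
  have p1 := normr_ge0 ((1 - r) * x.1); have p2 := normr_ge0 ((1 - r) * x.2).
  have nr : `|r| = r by rewrite gtr0_norm.
  split; rewrite ler_pdivlMr// -[X in _ * X]nr -normrM mulrC.
    have -> : r * y.1 = (r * y.1 + (1 - r) * x.1) - (1 - r) * x.1 by ring.
    by apply: le_trans (ler_normB _ _) _; rewrite /P; lra.
  have -> : r * y.2 = (r * y.2 + (1 - r) * x.2) - (1 - r) * x.2 by ring.
  by apply: le_trans (ler_normB _ _) _; rewrite /P; lra.
- move=> y [Ky]; rewrite /halfspace2 /= => ye.
  rewrite /homothety /=; split; first by apply: cK => //; rewrite ltW.
  have -> : dot2 u (r * y.1 + (1 - r) * x.1, r * y.2 + (1 - r) * x.2) =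
      r * dot2 u y + (1 - r) * a by rewrite /a /dot2 /=; ring.
  have : r * dot2 u y <= r * e by rewrite ler_pM2l.
  have : r * (e - a) = d - a by rewrite /r divfK// gt_eqF.
  lra.
Qed.

End Moves.

(** * The widest slab with prescribed caps *)

Section Maximum.
Context {R : realType}.
Implicit Types (K : set (R * R)) (u v : R * R).

Lemma dot2_unit_le (M : R) u x : dot2 u u = 1 -> `|x.1| <= M -> `|x.2| <= M ->
  `|dot2 u x| <= 2 * M.
Proof.
rewrite /dot2 => uu h1 h2; have M0 : 0 <= M by apply: le_trans h1.
have u1 : `|u.1| <= 1 by rewrite ler_norml; apply/andP; split; nra.
have u2 : `|u.2| <= 1 by rewrite ler_norml; apply/andP; split; nra.
apply: le_trans (ler_normD _ _) _; rewrite !normrM.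
have -> : 2 * M = 1 * M + 1 * M by ring.
by apply: lerD; apply: ler_pM.
Qed.

Lemma cap_full K u (M d : R) : (forall x, K x -> `|x.1| <= M /\ `|x.2| <= M) ->
  dot2 u u = 1 -> 2 * M <= d -> cap K u d = vol2 K.
Proof.
move=> KM uu Md; rewrite /cap; congr vol2; apply/setIidPl => x /KM[h1 h2].
rewrite /halfspace2 /=; apply: le_trans Md.
by apply: le_trans (dot2_unit_le uu h1 h2); exact: ler_norm.
Qed.

Lemma cap_empty K u (M d : R) : (forall x, K x -> `|x.1| <= M /\ `|x.2| <= M) ->
  dot2 u u = 1 -> d < - (2 * M) -> cap K u d = 0.
Proof.
move=> KM uu Md; rewrite /cap (_ : _ `&` _ = set0) ?/vol2 ?measure0//.
rewrite -subset0 => x [/KM[h1 h2]]; rewrite /halfspace2 /= => xd.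
by have := dot2_unit_le uu h1 h2; rewrite ler_norml => /andP[]; lra.
Qed.

(** Upper semicontinuity of the cap area. On the bounded set [K], a small change of direction and
    level is absorbed by a slightly larger level in the limit direction, where the area is
    Lipschitz; the unit condition keeps that direction nonzero. *)
Lemma closed_cap_ge K (al : R) : measurable K -> bounded2 K ->
  closed [set p : (R * R) * R | dot2 p.1 p.1 = 1 /\ al <= cap K p.1 p.2].
Proof.
move=> mK bK; set A := mkset _.
have c1 (T : topologicalType) (f : T -> R * R) : continuous f ->
    continuous (fun z => (f z).1).
  by move=> cf z; apply: cvg_comp (cf z) _; exact: cvg_fst.
have c2 (T : topologicalType) (f : T -> R * R) : continuous f ->
    continuous (fun z => (f z).2).
  by move=> cf z; apply: cvg_comp (cf z) _; exact: cvg_snd.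
have cfst : continuous (fst : (R * R) * R -> R * R) by move=> z; exact: cvg_fst.
move=> [u d] clA.
have uu : dot2 u u = 1.
  have cl1 : closed [set p : (R * R) * R | dot2 p.1 p.1 = 1].
    rewrite (_ : mkset _ = (fun p : (R * R) * R => dot2 p.1 p.1) @^-1` [set 1])//.
    apply: closed_comp; last exact: closed_eq.
    move=> p _; rewrite /dot2; apply: cvgD; apply: cvgM; first [exact: c1|exact: c2].
  have : closure A `<=` [set p : (R * R) * R | dot2 p.1 p.1 = 1].
    by apply: subset_trans cl1; apply: closureS => p [].
  by move=> /(_ _ clA).
split => //=.
have u0 : u != 0.
  apply/eqP => u0; move: uu; rewrite u0 /dot2 /= !mul0r addr0.
  by move/eqP; rewrite eq_sym oner_eq0.
have [C C0 CP] := cap_lipschitz mK bK u0.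
have [M0 KM0] := bK.
pose M : R := `|M0|.
have M_ge0 : 0 <= M by exact: normr_ge0.
have KM x : K x -> `|x.1| <= M /\ `|x.2| <= M.
  by move=> /KM0[h1 h2]; split; apply: le_trans (ler_norm M0).
apply/ler_addgt0Pr => e e0.
(* Moving [u] and [d] by [eta] costs at most [eta (1 + 2 M)] in the level, hence at most [e] in the
   area. *)
pose k := (C + 1) * (1 + 2 * M).
have k0 : 0 < k by rewrite mulr_gt0//; lra.
pose eta := e / k.
have eta0 : 0 < eta by rewrite divr_gt0.
have nb : nbhs (u, d) [set p : (R * R) * R |
    (`|u.1 - p.1.1| < eta /\ `|u.2 - p.1.2| < eta) /\ `|d - p.2| < eta].
  exists ([set q : R * R | `|u.1 - q.1| < eta /\ `|u.2 - q.2| < eta],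
          [set r : R | `|d - r| < eta]) => /=; last by move=> p [].
  split; last by exists eta.
  exists ([set r : R | `|u.1 - r| < eta], [set r : R | `|u.2 - r| < eta]) => /=.
    by split; exists eta.
  by move=> p [].
have [[u' d'] [[_ al'] /= [[e1 e2] e3]]] := clA _ nb.
rewrite /= in al'; apply: le_trans al' _.
have step1 : cap K u' d' <= cap K u (d + eta * (1 + 2 * M)).
  apply: le_vol2.
  - by apply: measurableI => //; exact: measurable_halfspace2.
  - by apply: measurableI => //; exact: measurable_halfspace2.
  - by apply: bounded2S bK; exact: subIsetl.
  move=> x [Kx]; rewrite /halfspace2 /= => xd; split => //; rewrite /halfspace2 /=.
  have [x1 x2] := KM _ Kx.
  have d1 : `|(u.1 - u'.1) * x.1| <= eta * M by rewrite normrM; apply: ler_pM => //; exact: ltW.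
  have d2 : `|(u.2 - u'.2) * x.2| <= eta * M by rewrite normrM; apply: ler_pM => //; exact: ltW.
  have d3 : d' - d < eta by apply: le_lt_trans e3; rewrite distrC; exact: ler_norm.
  have := ler_norm ((u.1 - u'.1) * x.1); have := ler_norm ((u.2 - u'.2) * x.2).
  move: xd; rewrite /dot2; lra.
have h : d < d + eta * (1 + 2 * M) by rewrite ltrDl mulr_gt0//; lra.
apply: le_trans step1 _; apply: le_trans (CP _ _ h) _; rewrite lerD2l addrC addKr.
have -> : e = eta * k by rewrite /eta divfK// gt_eqF.
have : 0 <= eta * (1 + 2 * M) by rewrite mulr_ge0//; lra.
by rewrite /k; lra.
Qed.

Lemma cap_scale K u (c d : R) : 0 < c -> cap K (c * u.1, c * u.2) (c * d) = cap K u d.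
Proof.
move=> c0; rewrite /cap; congr (vol2 (_ `&` _)); apply/seteqP; split => x.
  rewrite /halfspace2 /= /dot2 /= -!mulrA -mulrDr ler_pM2l//.
by rewrite /halfspace2 /= /dot2 /= -!mulrA -mulrDr ler_pM2l.
Qed.

Lemma clamp_bounds (m a : R) : 0 <= m ->
  (- m <= a -> - m <= Num.min a m <= m) /\ (a <= m -> - m <= Num.max a (- m) <= m).
Proof.
move=> m0; split=> h; first by rewrite le_min h ge_min lexx orbT /= andbT; lra.
by rewrite le_max lexx orbT /= ge_max h /=; lra.
Qed.

(** The width is maximised over a compact set of unit directions and bounded levels. The factor
    [Num.sqrt (dot2 u' u')] normalises competitors, since tilted directions are not unit vectors. *)
Lemma exists_widest_slab K (al : R) : measurable K -> bounded2 K ->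
  0 < al -> al <= vol2 K ->
  exists u d1 d2, [/\ dot2 u u = 1, al <= cap K u d1, al <= cap K (- u) (- d2) &
    forall u' d1' d2', u' != 0 -> al <= cap K u' d1' -> al <= cap K (- u') (- d2') ->
      d2' - d1' <= (d2 - d1) * Num.sqrt (dot2 u' u')].
Proof.
move=> mK bK al0 alK; have [M0 KM0] := bK.
pose M : R := `|M0|.
have M_ge0 : 0 <= M by exact: normr_ge0.
have KM x : K x -> `|x.1| <= M /\ `|x.2| <= M.
  by move=> /KM0[h1 h2]; split; apply: le_trans (ler_norm M0).
pose A := [set p : (R * R) * R | dot2 p.1 p.1 = 1 /\ al <= cap K p.1 p.2].
have cA : closed A by exact: closed_cap_ge.
pose Q : set ((R * R) * (R * R)) :=
  (`[-1, 1] `*` `[-1, 1]) `*` (`[- (2 * M), 2 * M] `*` `[- (2 * M), 2 * M]).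
pose S := Q `&` ((fun p => (p.1, p.2.1)) @^-1` A `&`
  (fun p => (- p.1, - p.2.2)) @^-1` A).
have cS : compact S.
  apply: compact_closedI.
    by repeat apply: compact_setX; exact: segment_compact.
  have cf1 : continuous (fst : (R * R) * (R * R) -> R * R) by move=> z; exact: cvg_fst.
  have cf2 : continuous (snd : (R * R) * (R * R) -> R * R) by move=> z; exact: cvg_snd.
  have cpair (T U V : topologicalType) (f : T -> U) (g : T -> V) :
      continuous f -> continuous g -> continuous (fun z => (f z, g z)).
    by move=> cf cg z; exact: cvg_pair (cf z) (cg z).
  have cc (T U V : topologicalType) (f : T -> U) (g : U -> V) :
      continuous f -> continuous g -> continuous (g \o f).
    by move=> cf cg z; apply: continuous_comp; [exact: cf|exact: cg].
  have co1 : continuous (-%R : R * R -> R * R) by exact: opp_continuous.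
  have co2 : continuous (-%R : R -> R) by exact: opp_continuous.
  have cg1 : continuous (fst : R * R -> R) by move=> z; exact: cvg_fst.
  have cg2 : continuous (snd : R * R -> R) by move=> z; exact: cvg_snd.
  apply: closedI; apply: closed_comp => // p _.
    by apply: cpair p => //; exact: cc cf2 cg1.
  by apply: cpair p; [exact: cc cf1 co1|exact: cc (cc _ _ _ _ _ cf2 cg2) co2].
have Sin u d1 d2 : dot2 u u = 1 -> - (2 * M) <= d1 <= 2 * M ->
    - (2 * M) <= d2 <= 2 * M -> al <= cap K u d1 -> al <= cap K (- u) (- d2) ->
    S (u, (d1, d2)).
  move=> uu h1 h2 h3 h4.
  have nn : dot2 (- u) (- u) = 1 by rewrite -uu /dot2 /=; ring.
  rewrite /dot2 in uu.
  split; last by split; split.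
  split; split; rewrite /= in_itv /=; [| |exact: h1|exact: h2].
    by apply/andP; split; nra.
  by apply/andP; split; nra.
have un : dot2 (1, 0) (1, 0) = 1 :> R by rewrite /dot2 /= mulr1 mulr0 addr0.
have unn : dot2 (- (1, 0)) (- (1, 0)) = 1 :> R by rewrite /dot2 /=; ring.
have S0 : S !=set0.
  (* Both caps are all of [K] here; the width is allowed to be negative at this stage. *)
  exists ((1, 0), (2 * M, - (2 * M))); apply: (Sin _ _ _ un).
  - by apply/andP; split; lra.
  - by apply/andP; split; lra.
  - by rewrite (cap_full KM un).
  - by rewrite opprK (cap_full KM unn).
pose f (p : (R * R) * (R * R)) : R := p.2.2 - p.2.1.
have cf : continuous f.
  move=> p; have h : snd @ p --> p.2 by exact: cvg_snd.
  by apply: cvgB; apply: cvg_comp h _; [exact: cvg_snd|exact: cvg_fst].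
have [[u [d1 d2]] + max] := compact_EVT_max S0 cS (continuous_subspaceT cf).
rewrite inE => -[_ [[/= uu h1] [/= _ h2]]].
exists u, d1, d2; split => // u' d1' d2' u'0 h1' h2'.
pose n := Num.sqrt (dot2 u' u').
have dd : 0 < dot2 u' u'.
  rewrite /dot2 lt_neqAle addr_ge0 ?andbT -?expr2 ?sqr_ge0//.
  rewrite eq_sym paddr_eq0 ?sqr_ge0// !sqrf_eq0; apply: contra u'0 => /andP[/eqP a /eqP b].
  by apply/eqP; rewrite (surjective_pairing u') a b.
have n0 : 0 < n by rewrite sqrtr_gt0.
pose w := (n^-1 * u'.1, n^-1 * u'.2).
have n0' : 0 < n^-1 by rewrite invr_gt0.
have ww : dot2 w w = 1.
  have -> : dot2 w w = n ^- 2 * dot2 u' u' by rewrite /dot2 /= -exprVn; ring.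
  by rewrite -(sqr_sqrtr (ltW dd)) mulVf// sqrf_eq0 gt_eqF.
have wwn : dot2 (- w) (- w) = 1 by rewrite -ww /dot2 /=; ring.
have k1 : al <= cap K w (n^-1 * d1') by rewrite cap_scale.
have k2 : al <= cap K (- w) (- (n^-1 * d2')).
  have -> : - w = (n^-1 * (- u').1, n^-1 * (- u').2) by congr pair; rewrite /= mulrN.
  by rewrite -mulrN cap_scale.
have neq0 (c : R) : c = 0 -> al <= c -> False by move=> ->; rewrite leNgt al0.
have b1 : - (2 * M) <= n^-1 * d1'.
  by rewrite leNgt; apply/negP => /(cap_empty KM ww)/neq0; exact.
have b2 : n^-1 * d2' <= 2 * M.
  by rewrite leNgt; apply/negP; rewrite -ltrN2 => /(cap_empty KM wwn)/neq0; exact.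
have M2 : 0 <= 2 * M by rewrite mulr_ge0.
rewrite -/n -ler_pdivrMr// mulrC mulrBr.
(* Clamping the levels to [[- 2 M, 2 M]] keeps both caps large, because a cap at a clamped level is
   all of [K], and it does not decrease the width. *)
have c1 : al <= cap K w (Num.min (n^-1 * d1') (2 * M)).
  by rewrite /Num.min; case: ifPn => [_|_]; [exact: k1|rewrite (cap_full KM ww)].
have c2 : al <= cap K (- w) (- Num.max (n^-1 * d2') (- (2 * M))).
  rewrite /Num.max; case: ifPn => [_|_]; last exact: k2.
  by rewrite opprK (cap_full KM wwn).
have /mem_set/max : S (w, (Num.min (n^-1 * d1') (2 * M), Num.max (n^-1 * d2') (- (2 * M)))).
  exact: (Sin _ _ _ ww ((clamp_bounds _ M2).1 b1) ((clamp_bounds _ M2).2 b2) c1 c2).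
rewrite /f /=; apply: le_trans; apply: lerB; first by rewrite le_max lexx.
by rewrite ge_min lexx.
Qed.

End Maximum.

(** * Chords of the widest slab *)

Section LowerBound.
Context {R : realType}.
Implicit Types (K : set (R * R)) (u v : R * R).

Definition chord K u v (d f g : R) := [/\ K (frame u v d f), K (frame u v d g) &
  forall t, K (frame u v d t) -> f <= t <= g].

Lemma chord_opp K u v d f g : chord K u v d f g -> chord K (- u) (- v) (- d) (- g) (- f).
Proof.
move=> [h1 h2 h3]; split; rewrite ?frame_opp ?opprK// => t.
by rewrite frame_opp opprK => /h3/andP[a b]; apply/andP; split; lra.
Qed.

Lemma chord_oppr K u v d f g : chord K u v d f g -> chord K u (- v) d (- g) (- f).
Proof.
move=> [h1 h2 h3]; split; rewrite ?frame_oppr ?opprK// => t.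
by rewrite frame_oppr => /h3/andP[a b]; apply/andP; split; lra.
Qed.

Lemma interior_segment K u v : orthonormal u v -> interior K !=set0 ->
  exists p q e : R, [/\ 0 < e, K (frame u v p (q + e)) & K (frame u v p (q - e))].
Proof.
move=> uv [P [[U V] [/= Ua Vb] UVK]].
have [e /= e0 eU] := Ua; have [d /= d0 dV] := Vb.
pose m := Num.min e d.
have m0 : 0 < m by rewrite lt_min e0.
have me : m <= e by rewrite ge_min lexx.
have md : m <= d by rewrite ge_min lexx orbT.
have [_ vv _] := uv; rewrite /dot2 in vv.
have v1 : `|v.1| <= 1 by rewrite ler_norml; apply/andP; split; nra.
have v2 : `|v.2| <= 1 by rewrite ler_norml; apply/andP; split; nra.
have key (r : R) : `|r| < m -> K (frame u v (dot2 u P) (dot2 v P + r)).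
  move=> rm; have -> : frame u v (dot2 u P) (dot2 v P + r) =
      (P.1 + r * v.1, P.2 + r * v.2).
    by rewrite -[in RHS](frame_dot2 P uv) /frame /=; congr pair; ring.
  apply: UVK; split => /=.
    apply: eU; rewrite /= opprD addNKr normrN normrM.
    by apply: lt_le_trans me; apply: le_lt_trans rm; rewrite ler_piMr.
  apply: dV; rewrite /= opprD addNKr normrN normrM.
  by apply: lt_le_trans md; apply: le_lt_trans rm; rewrite ler_piMr.
exists (dot2 u P), (dot2 v P), (m / 2); split; first by rewrite divr_gt0.
  by apply: key; rewrite gtr0_norm ?divr_gt0//; lra.
by apply: key; rewrite normrN gtr0_norm ?divr_gt0//; lra.
Qed.

(** Joining a small segment in [K] parallel to [v] with [x] or [y] gives a nondegenerate segment at
    level [d]; the extreme points at this level exist by compactness. *)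
Lemma chord_exists K u v (d : R) x y : compact K -> convex2 K -> interior K !=set0 ->
  orthonormal u v -> K x -> K y -> dot2 u x < d -> d < dot2 u y ->
  exists f g, f < g /\ chord K u v d f g.
Proof.
move=> coK cK iK uv Kx Ky xd dy.
have ck := @convexr_frame R K u v cK.
have [p [q [e [e0 k1 k2]]]] := interior_segment uv iK.
have [f0 [g0 [fg0 kf kg]]] : exists f0 g0 : R,
    [/\ f0 < g0, K (frame u v d f0) & K (frame u v d g0)].
  have key (z w l : R) : K (frame u v z w) -> 0 < l -> l <= 1 -> l * p + (1 - l) * z = d ->
      exists f0 g0 : R, [/\ f0 < g0, K (frame u v d f0) & K (frame u v d g0)].
    move=> kz l0 l1 ld; have l01 : 0 <= l <= 1 by rewrite ltW.
    exists (l * (q - e) + (1 - l) * w), (l * (q + e) + (1 - l) * w); split.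
    - have : 0 < l * e by rewrite mulr_gt0.
      by lra.
    - by rewrite -ld; exact: (ck _ _ _ _ _ k2 kz l01).
    - by rewrite -ld; exact: (ck _ _ _ _ _ k1 kz l01).
  (* The point on the other side of level [d] is taken, so that the small segment gets a positive
     weight. *)
  have [pd|dp] := leP p d.
    have h : 0 < dot2 u y - p by lra.
    apply: (key (dot2 u y) (dot2 v y) ((dot2 u y - d) / (dot2 u y - p))).
    - by rewrite frame_dot2.
    - by rewrite divr_gt0//; lra.
    - by rewrite ler_pdivrMr//; lra.
    - by field; lra.
  have h : 0 < p - dot2 u x by lra.
  apply: (key (dot2 u x) (dot2 v x) ((d - dot2 u x) / (p - dot2 u x))).
  - by rewrite frame_dot2.
  - by rewrite divr_gt0//; lra.
  - by rewrite ler_pdivrMr//; lra.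
  - by field; lra.
pose L := K `&` [set z | dot2 u z = d].
have cL : compact L.
  apply: compact_closedI => //.
  rewrite (_ : mkset _ = dot2 u @^-1` [set d])//.
  by apply: closed_comp => [z _|]; [exact: continuous_dot2|exact: closed_eq].
have LE t : L (frame u v d t) <-> K (frame u v d t).
  by rewrite /L /= dot2_frame_l//; split => // -[].
have L0 : L !=set0 by exists (frame u v d f0); apply/LE.
have cv : {within L, continuous (dot2 v)}.
  by apply: continuous_subspaceT; exact: continuous_dot2.
have [a aL amax] := compact_EVT_max L0 cL cv.
have [b bL bmin] := compact_EVT_min L0 cL cv.
have [Ka ua] : L a by rewrite -in_setE.
have [Kb ub] : L b by rewrite -in_setE.
have ch t : K (frame u v d t) -> dot2 v b <= t <= dot2 v a.
  move=> /LE/mem_set kt; have := amax _ kt; have := bmin _ kt.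
  by rewrite dot2_frame_r// => -> ->.
exists (dot2 v b), (dot2 v a); split.
  by have /andP[? _] := ch _ kf; have /andP[_ ?] := ch _ kg; lra.
rewrite /= in ua ub; split; [rewrite -ub| rewrite -ua|exact: ch]; by rewrite frame_dot2.
Qed.

Lemma chord_between K u v (d f g t : R) : convex2 K -> f < g -> chord K u v d f g ->
  f <= t <= g -> K (frame u v d t).
Proof.
move=> cK fg [kf kg _] /andP[ft tg].
have gf : 0 < g - f by lra.
have := @convexr_frame R K u v cK _ _ _ _ ((g - t) / (g - f)) kf kg.
have -> : (g - t) / (g - f) * d + (1 - (g - t) / (g - f)) * d = d by ring.
have -> : (g - t) / (g - f) * f + (1 - (g - t) / (g - f)) * g = t by field; lra.
by apply; rewrite divr_ge0/= ?ler_pdivrMr//; lra.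
Qed.

(** The tilted direction has length [Num.sqrt (1 + tau ^+ 2)]: normalising it costs only second
    order in the tilt, against a first-order gain in width. *)
Lemma sqrtr1D_le (t : R) : Num.sqrt (1 + t ^+ 2) <= 1 + t ^+ 2 / 2.
Proof.
have t2 := sqr_ge0 t; have e : 0 <= 1 + t ^+ 2 / 2 by lra.
by rewrite -[X in _ <= X]ger0_norm// -sqrtr_sqr ler_sqrt ?sqr_ge0//; nra.
Qed.

(* If the midpoint of the first chord is above that of the second, tilt the lines about points
   slightly below the first and slightly above the second: no cap shrinks, and to first
   order the width grows by the tilt times the offset of these points. *)
Lemma widest_slab_midpoints_le K u v (d1 d2 f1 g1 f2 g2 : R) x y :
  measurable K -> bounded2 K -> convex2 K -> orthonormal u v -> d1 < d2 ->
  f1 < g1 -> f2 < g2 -> chord K u v d1 f1 g1 -> chord K u v d2 f2 g2 ->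
  K x -> K y -> dot2 u x < d2 -> d1 < dot2 u y ->
  (forall u' d1' d2', u' != 0 -> cap K u d1 <= cap K u' d1' ->
     cap K (- u) (- d2) <= cap K (- u') (- d2') ->
     d2' - d1' <= (d2 - d1) * Num.sqrt (dot2 u' u')) ->
  f1 + g1 <= f2 + g2.
Proof.
move=> mK bK cK uv d12 fg1 fg2 ch1 ch2 Kx Ky xd dy max.
rewrite leNgt; apply/negP => mu.
(* The eighth keeps the offset [nu1 - nu2] positive, the quarters keep the pivots on their
   chords. *)
pose del := Num.min ((f1 + g1 - (f2 + g2)) / 8) (Num.min ((g1 - f1) / 4) ((g2 - f2) / 4)).
have del0 : 0 < del by rewrite !lt_min !divr_gt0//; lra.
have del1 : del <= (f1 + g1 - (f2 + g2)) / 8 by rewrite ge_min lexx.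
have del2 : del <= (g1 - f1) / 4 by rewrite !ge_min lexx orbT.
have del3 : del <= (g2 - f2) / 4 by rewrite !ge_min lexx !orbT.
pose nu1 := (f1 + g1) / 2 - del; pose nu2 := (f2 + g2) / 2 + del.
have k1 : K (frame u v d1 nu1).
  by apply: (chord_between cK fg1 ch1); rewrite /nu1; apply/andP; split; lra.
have k2 : K (frame (- u) (- v) (- d2) (- nu2)).
  rewrite frame_opp !opprK; apply: (chord_between cK fg2 ch2).
  by rewrite /nu2; apply/andP; split; lra.
have [_ kg1 kf1] := ch1; have [_ kg2 kf2] := chord_opp ch2.
have ly : K (frame u v (dot2 u y) (dot2 v y)) by rewrite frame_dot2.
have lx : K (frame (- u) (- v) (- dot2 u x) (- dot2 v x)).
  by rewrite frame_opp !opprK frame_dot2.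
have kf1' t : K (frame u v d1 t) -> f1 <= t by move=> /kf1 /andP[].
have kf2' t : K (frame (- u) (- v) (- d2) t) -> - g2 <= t by move=> /kf2 /andP[].
have h1 : nu1 - f1 < g1 - nu1 by rewrite /nu1; lra.
have h2 : - nu2 - - g2 < - f2 - - nu2 by rewrite /nu2; lra.
have xd' : - d2 < - dot2 u x by lra.
have [t1 t10 T1] := cap_tilt mK bK cK uv k1 kg1 kf1' ly dy h1.
have [t2 t20 T2] := cap_tilt mK bK cK (orthonormal_opp uv) k2 kg2 kf2' lx xd' h2.
pose kap := nu1 - nu2.
have kap0 : 0 < kap by rewrite /kap /nu1 /nu2; lra.
pose D := d2 - d1.
have D0 : 0 < D by rewrite /D; lra.
(* With [tau < kap / D], the gain [tau * kap] exceeds the cost [D * tau ^+ 2 / 2] of normalising. *)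
pose tau := Num.min (Num.min t1 t2) (kap / D) / 2.
have m0 : 0 < Num.min (Num.min t1 t2) (kap / D) by rewrite !lt_min t10 t20 divr_gt0.
have tau0 : 0 < tau by rewrite divr_gt0.
have taum : tau < Num.min (Num.min t1 t2) (kap / D) by rewrite /tau; lra.
move: taum; rewrite !lt_min -andbA => /and3P[tt1 tt2 tk].
have tb1 : 0 < tau < t1 by rewrite tau0.
have tb2 : 0 < tau < t2 by rewrite tau0.
have C1 := T1 _ tb1; have C2 := T2 _ tb2.
set u' := u - (tau * v.1, tau * v.2) in C1.
(* Tilting the second line by the same [tau] in the frame [- u], [- v] gives the direction [- u'],
   so the two new lines are parallel. *)
have eu : - u - (tau * (- v).1, tau * (- v).2) = - u' by rewrite /u'; congr pair => /=; ring.
have ed : - d2 - tau * - nu2 = - (d2 - tau * nu2) by ring.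
rewrite eu ed in C2.
have uu' : dot2 u' u' = 1 + tau ^+ 2.
  have [uu vv uv0] := uv.
  have -> : dot2 u' u' = dot2 u u + tau ^+ 2 * dot2 v v - 2 * tau * dot2 u v.
    by rewrite /dot2 /u' /=; ring.
  by rewrite uu vv uv0; ring.
have u'0 : u' != 0.
  apply/eqP => z; move: uu'; rewrite z /dot2 /= !mul0r addr0.
  by move=> h; have := sqr_ge0 tau; clear - h; lra.
have := max _ _ _ u'0 C1 C2; rewrite uu'.
have : D * Num.sqrt (1 + tau ^+ 2) <= D * (1 + tau ^+ 2 / 2) by rewrite ler_pM2l// sqrtr1D_le.
rewrite ltr_pdivlMr// in tk.
have : tau * (tau * D) < tau * kap by rewrite ltr_pM2l.
have : 0 < tau * kap by rewrite mulr_gt0.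
by rewrite /kap /D; clear; lra.
Qed.

(** Maximality makes the caps exactly [al]: a larger one would leave room to widen the slab. Two
    caps of area [al] cannot cover [K], whence [d1 < d2]. *)
Lemma exists_isosceles_slab K (al : R) : convex_body2 K -> 0 < al -> 2 * al < vol2 K ->
  exists u v d1 d2 f1 g1 f2 g2, [/\ orthonormal u v, d1 < d2,
    cap K u d1 = al, cap K (- u) (- d2) = al & [/\ f1 < g1, f2 < g2,
    chord K u v d1 f1 g1, chord K u v d2 f2 g2 & f1 + g1 = f2 + g2]].
Proof.
move=> [coK [cK iK]] al0 al2.
have mK := compact_measurable2 coK; have bK := compact_bounded2 coK.
have [|u [d1 [d2 [uu a1 a2 max]]]] := @exists_widest_slab R K al mK bK al0; first by lra.
pose v : R * R := (- u.2, u.1).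
have uv : orthonormal u v.
  by split => //; [rewrite -uu /dot2 /=; ring|rewrite /dot2 /=; ring].
have u0 := orthonormal_neq0 uv.
have uN0 : - u != 0 by rewrite oppr_eq0.
have s1 : Num.sqrt (dot2 u u) = 1 by rewrite uu sqrtr1.
have e1 : cap K u d1 = al.
  apply/eqP; rewrite eq_le a1 andbT leNgt; apply/negP => lt.
  have [C C0 CP] := cap_lipschitz mK bK u0.
  (* By the Lipschitz bound, moving the line by [de] loses no more than the excess over [al]. *)
  pose de := (cap K u d1 - al) / (C + 1).
  have de0 : 0 < de by rewrite divr_gt0//; clear - lt C0; lra.
  have dl : d1 - de < d1 by clear - de0; lra.
  have := CP _ _ dl; have -> : d1 - (d1 - de) = de by ring.
  move=> h.
  have dE : de * (C + 1) = cap K u d1 - al by rewrite /de divfK//; clear - C0; lra.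
  have h' : al <= cap K u (d1 - de) by clear - h dE de0; lra.
  by have := max _ (d1 - de) d2 u0 h' a2; rewrite s1 mulr1; clear - de0; lra.
have e2 : cap K (- u) (- d2) = al.
  apply/eqP; rewrite eq_le a2 andbT leNgt; apply/negP => lt.
  have [C C0 CP] := cap_lipschitz mK bK uN0.
  pose de := (cap K (- u) (- d2) - al) / (C + 1).
  have de0 : 0 < de by rewrite divr_gt0//; clear - lt C0; lra.
  have dl : - (d2 + de) < - d2 by clear - de0; lra.
  have := CP _ _ dl; have -> : - d2 - - (d2 + de) = de by ring.
  move=> h.
  have dE : de * (C + 1) = cap K (- u) (- d2) - al by rewrite /de divfK//; clear - C0; lra.
  have h' : al <= cap K (- u) (- (d2 + de)) by clear - h dE de0; lra.
  by have := max _ d1 (d2 + de) u0 a1 h'; rewrite s1 mulr1; clear - de0; lra.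
have d12 : d1 < d2.
  rewrite ltNge; apply/negP => d21.
  have := cap_opp d1 mK bK u0.
  have : cap K (- u) (- d1) <= cap K (- u) (- d2) by apply: cap_mono => //; clear - d21; lra.
  by rewrite e1 e2; clear - al2; lra.
(* A cap of area [al] is neither null nor all of [K], so [K] has points strictly on both sides of
   each line. *)
have half w d : w != 0 -> cap K w d = al -> exists2 x, K x & d < dot2 w x.
  move=> w0 cw; apply: contrapT => nex.
  have : cap K w d = vol2 K.
    rewrite /cap; congr vol2; apply/setIidPl => x Kx; rewrite /halfspace2 /= leNgt.
    by apply/negP => lt; apply: nex; exists x.
  by rewrite cw; clear - al0 al2; lra.
have half' w d : w != 0 -> cap K w d = al -> exists2 x, K x & dot2 w x < d.
  move=> w0 cw; apply: contrapT => nex.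
  have : cap K w d = 0.
    rewrite -(vol2_line0 d mK bK w0) /cap; congr vol2; apply/seteqP; split => x.
      move=> [Kx xd]; split => //=; apply/eqP; rewrite eq_le xd /= leNgt.
      by apply/negP => lt; apply: nex; exists x.
    by move=> [Kx /= xd]; split => //; rewrite /halfspace2 /= xd.
  by rewrite cw; clear - al0; lra.
have [y1 Ky1 hy1] := half _ _ u0 e1.
have [x1 Kx1 hx1] := half' _ _ u0 e1.
have [x2 Kx2 hx2] := half _ _ uN0 e2.
have [y2 Ky2 hy2] := half' _ _ uN0 e2.
rewrite !dot2N !ltrN2 in hx2 hy2.
have [f1 [g1 [fg1 ch1]]] := chord_exists coK cK iK uv Kx1 Ky1 hx1 hy1.
have [f2 [g2 [fg2 ch2]]] := chord_exists coK cK iK uv Kx2 Ky2 hx2 hy2.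
have max' u' d1' d2' : u' != 0 -> cap K u d1 <= cap K u' d1' ->
     cap K (- u) (- d2) <= cap K (- u') (- d2') ->
     d2' - d1' <= (d2 - d1) * Num.sqrt (dot2 u' u').
  by rewrite e1 e2; exact: max.
exists u, v, d1, d2, f1, g1, f2, g2; split => //; split => //.
apply/eqP; rewrite eq_le.
rewrite (widest_slab_midpoints_le mK bK cK uv d12 fg1 fg2 ch1 ch2 Kx2 Ky1 hx2 hy1 max') /=.
have fg1' : - g1 < - f1 by clear - fg1; lra.
have fg2' : - g2 < - f2 by clear - fg2; lra.
(* The reverse inequality comes from the mirrored frame [u], [- v]. *)
have := widest_slab_midpoints_le mK bK cK (orthonormal_oppr uv) d12 fg1' fg2'
  (chord_oppr ch1) (chord_oppr ch2) Kx2 Ky1 hx2 hy1 max'.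
by clear; lra.
Qed.

End LowerBound.

(** * Lower bounds *)

Section Folding.
Context {R : realType}.
Implicit Types (K : set (R * R)) (u v a : R * R).

Lemma sym_fold2_ge K a (c : R) : measurable K -> bounded2 K -> a != 0 ->
  is_fold K a c -> 2 / vol2 K * cap K a c <= sym_fold2 K.
Proof.
move=> mK bK a0 h; apply: ler_wpM2l; first by rewrite divr_ge0// vol2_ge0.
apply: ub_le_sup; last by exists a, c.
exists (vol2 K) => _ [b [d [_ [_ ->]]]]; exact: cap_le_vol2.
Qed.

(** With a common midpoint, the shorter chord projects into the longer one. Either chord may be the
    shorter one, so the depths of both caps are bounded. *)
Lemma isosceles_slab_fold K u v (d1 d2 f1 g1 f2 g2 al : R) : convex_body2 K ->
  orthonormal u v -> d1 < d2 -> cap K u d1 = al -> cap K (- u) (- d2) = al ->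
  chord K u v d1 f1 g1 -> chord K u v d2 f2 g2 -> f1 + g1 = f2 + g2 ->
  (forall x, K x -> d1 - dot2 u x <= d2 - d1) ->
  (forall x, K x -> dot2 u x - d2 <= d2 - d1) ->
  2 / vol2 K * al <= sym_fold2 K.
Proof.
move=> [coK [cK iK]] uv d12 e1 e2 ch1 ch2 mid dep1 dep2.
have mK := compact_measurable2 coK; have bK := compact_bounded2 coK.
have u0 := orthonormal_neq0 uv.
have uN0 : - u != 0 by rewrite oppr_eq0.
have [le|lt] := leP (g1 - f1) (g2 - f2).
  rewrite -e1; apply: sym_fold2_ge => //.
  have [k1 k2 k3] := ch1; have [k4 k5 _] := ch2.
  by apply: (is_fold_chords cK uv d12 k1 k2 k3 k4 k5 _ _ dep1); lra.
rewrite -e2; apply: sym_fold2_ge => //.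
have [k1 k2 k3] := chord_opp ch2; have [k4 k5 _] := chord_opp ch1.
have d21 : - d2 < - d1 by lra.
apply: (is_fold_chords cK (orthonormal_opp uv) d21 k1 k2 k3 k4 k5); [lra|lra|].
by move=> x /dep2; rewrite dot2N; lra.
Qed.

Lemma sym_fold2_general K : convex_body2 K -> 3 / 8 <= sym_fold2 K.
Proof.
move=> bodyK; have [coK [cK iK]] := bodyK.
have mK := compact_measurable2 coK; have bK := compact_bounded2 coK.
have V0 := vol2_gt0 mK bK iK; set V := vol2 K in V0.
(* Chosen so that [2 al / V = 3 / 8]. A cap deeper than the slab is wide would give
   [V - al <= 4 al], that is, [13 / 16 <= 12 / 16]. *)
pose al := 3 / 16 * V.
have al0 : 0 < al by rewrite /al; lra.
have al2 : 2 * al < V by rewrite /al; lra.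
have [u [v [d1 [d2 [f1 [g1 [f2 [g2 [uv d12 e1 e2 [fg1 fg2 ch1 ch2 mid]]]]]]]]]] :=
  exists_isosceles_slab bodyK al0 al2.
have u0 := orthonormal_neq0 uv.
have uN0 : - u != 0 by rewrite oppr_eq0.
have -> : 3 / 8 = 2 / V * al :> R by rewrite /al; field; rewrite gt_eqF.
have dep w (a b : R) : w != 0 -> a < b -> cap K w a = al -> cap K (- w) (- b) = al ->
    forall x, K x -> a - dot2 w x <= b - a.
  move=> w0 ab ea eb x Kx; rewrite leNgt; apply/negP => lt.
  have xa : dot2 w x < a by clear - ab lt; lra.
  have := cap_homothety_le mK bK cK Kx xa (ltW ab).
  have := cap_opp b mK bK w0; rewrite ea eb -/V => Eb.
  have q : (b - dot2 w x) / (a - dot2 w x) <= 2 by rewrite ler_pdivrMr; clear - ab lt; lra.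
  have q0 : 0 <= (b - dot2 w x) / (a - dot2 w x) by rewrite divr_ge0; clear - ab lt; lra.
  have : ((b - dot2 w x) / (a - dot2 w x)) ^+ 2 * al <= 2 ^+ 2 * al.
    by rewrite ler_pM2r// ler_sqr// nnegrE.
  by move: Eb; rewrite /al; clear - V0; lra.
apply: (isosceles_slab_fold bodyK uv d12 e1 e2 ch1 ch2 mid); first exact: dep e1 e2.
move=> x Kx; have d21 : - d2 < - d1 by lra.
have := dep (- u) (- d2) (- d1) uN0 d21 e2; rewrite !opprK => /(_ e1 x Kx).
by rewrite dot2N; lra.
Qed.

Definition point_refl (c x : R * R) : R * R := (2 * c.1 - x.1, 2 * c.2 - x.2).

(** The point reflection in [c] preserves area, maps [K] onto itself, being an involution, and
    exchanges the two half-planes. *)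
Lemma cap_point_refl K c u d : measurable K -> bounded2 K ->
  (forall x, K x -> K (point_refl c x)) -> cap K u d = cap K (- u) (d - 2 * dot2 u c).
Proof.
move=> mK bK Kc; rewrite /cap.
have mH : measurable (K `&` halfspace2 u d).
  by apply: measurableI => //; exact: measurable_halfspace2.
have := @vol2_homothety R (-1) (2 * c.1, 2 * c.2) (K `&` halfspace2 u d).
rewrite oppr_eq0 oner_eq0 sqrrN expr1n invr1 mul1r => /(_ isT mH) <-.
have E x : homothety (-1) (2 * c.1, 2 * c.2) x = point_refl c x.
  by rewrite /homothety /point_refl /=; congr pair; ring.
have D x : dot2 u (point_refl c x) = 2 * dot2 u c - dot2 u x.
  by rewrite /dot2 /point_refl /=; ring.
congr vol2; apply/seteqP; split => x; rewrite /= E.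
  move=> [Kx]; rewrite /halfspace2 /= D dot2N => h; split; last lra.
  have := Kc _ Kx; rewrite {1}/point_refl.
  by rewrite /point_refl /= !opprB !(addrC (2 * _)) !subrK -surjective_pairing.
move=> [Kx]; rewrite /halfspace2 /= dot2N => h; split; first exact: Kc.
by rewrite D; lra.
Qed.

(** The homothety with centre [y] and ratio [l] maps the interior onto an open subset of [K]. It
    enters through its inverse [h], so that openness is that of a preimage. *)
Lemma interior_toward K x y (l : R) : convex2 K -> interior K x -> K y ->
  0 < l -> l <= 1 -> interior K (l * x.1 + (1 - l) * y.1, l * x.2 + (1 - l) * y.2).
Proof.
move=> cK ix Ky l0 l1.
pose h := homothety l^-1 (- ((1 - l) / l) * y.1, - ((1 - l) / l) * y.2).
have lE (a b : R) : a = l * (l^-1 * a + - ((1 - l) / l) * b) + (1 - l) * b.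
  by field; rewrite gt_eqF.
have lE' (a b : R) : l^-1 * (l * a + (1 - l) * b) + - ((1 - l) / l) * b = a.
  by field; rewrite gt_eqF.
have ch : continuous h.
  have c1 : continuous (fun z => (h z).1).
    move=> z; apply: cvgD; last exact: cvg_cst.
    by apply: cvgM; [exact: cvg_cst|exact: cvg_fst].
  have c2 : continuous (fun z => (h z).2).
    move=> z; apply: cvgD; last exact: cvg_cst.
    by apply: cvgM; [exact: cvg_cst|exact: cvg_snd].
  by move=> z; exact: cvg_pair (c1 z) (c2 z).
have sub : h @^-1` interior K `<=` K.
  move=> z /interior_subset Khz; rewrite (surjective_pairing z).
  rewrite [z.1](lE _ y.1) [z.2](lE _ y.2).
  by apply: (cK _ _ Khz Ky) => //; exact: ltW.
have op : open (h @^-1` interior K).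
  by apply: open_comp; [move=> z _; exact: ch|exact: open_interior].
apply: (interiorS sub); move/interior_id : op => ->.
by rewrite /preimage /= /h /homothety /= !lE' -surjective_pairing.
Qed.

(** An interior point moved towards [x] or [y] reaches the middle level and stays interior, so an
    open piece of positive area lies between the two lines. *)
Lemma cap_lt K u (d e : R) x y : convex_body2 K -> u != 0 -> d < e ->
  K x -> K y -> dot2 u x < d -> e < dot2 u y -> cap K u d < cap K u e.
Proof.
move=> [coK [cK [p ip]]] u0 de Kx Ky xd ey.
have mK := compact_measurable2 coK; have bK := compact_bounded2 coK.
have [q iq [dq qe]] : exists2 q, interior K q & d < dot2 u q /\ dot2 u q < e.
  pose m := (d + e) / 2.
  have dm : d < m by rewrite /m; lra.
  have me : m < e by rewrite /m; lra.
  have key z (l : R) : K z -> 0 < l -> l <= 1 -> l * dot2 u p + (1 - l) * dot2 u z = m ->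
      exists2 q, interior K q & d < dot2 u q /\ dot2 u q < e.
    move=> Kz l0 l1 lm; eexists; first exact: (interior_toward cK ip Kz l0 l1).
    set w := dot2 u _; have -> : w = l * dot2 u p + (1 - l) * dot2 u z.
      by rewrite /w /dot2 /=; ring.
    by rewrite lm.
  have [pm|mp] := leP (dot2 u p) m.
    have h : 0 < dot2 u y - dot2 u p by lra.
    apply: (key y ((dot2 u y - m) / (dot2 u y - dot2 u p)) Ky).
    - by rewrite divr_gt0//; lra.
    - by rewrite ler_pdivrMr//; lra.
    - by field; lra.
  have h : 0 < dot2 u p - dot2 u x by lra.
  apply: (key x ((m - dot2 u x) / (dot2 u p - dot2 u x)) Kx).
  - by rewrite divr_gt0//; lra.
  - by rewrite ler_pdivrMr//; lra.
  - by field; lra.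
pose O : set (R * R) := dot2 u @^-1` `]d, e[ `&` interior K.
have oO : open O.
  apply: openI; last exact: open_interior.
  by apply: open_comp; [move=> z _; exact: continuous_dot2|exact: itv_open].
have mO : measurable O by exact: open_measurable2.
have bO : bounded2 O by apply: bounded2S bK => z [_ /interior_subset].
have Oq : O q by split => //; rewrite /= in_itv /= dq qe.
have vO : 0 < vol2 O.
  by apply: vol2_gt0 => //; exists q; move/interior_id : oO => ->.
have mKe : measurable (K `&` halfspace2 u e).
  by apply: measurableI => //; exact: measurable_halfspace2.
have bKe : bounded2 (K `&` halfspace2 u e) by apply: bounded2S bK; exact: subIsetl.
rewrite [in ltRHS]/cap (vol2_split mKe bKe (measurable_halfspace2 u d)).
rewrite (_ : _ `&` halfspace2 u d = K `&` halfspace2 u d); last first.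
  apply/seteqP; split => z; first by move=> [[]].
  by move=> [Kz zd]; split => //; split => //; exact: le_trans zd (ltW de).
rewrite ltrDl; apply: lt_le_trans vO _; apply: le_vol2 => //.
- by apply: measurableD => //; exact: measurable_halfspace2.
- by apply: bounded2S bKe; exact: subDsetl.
- move=> z [] /=; rewrite in_itv /= => /andP[dz ze] /interior_subset Kz; split.
    by split => //; exact: ltW.
  by apply/negP; rewrite -ltNge.
Qed.

Lemma sym_fold2_central K : convex_body2 K -> centrally_symmetric2 K ->
  4 / 9 <= sym_fold2 K.
Proof.
move=> bodyK [c Kc]; have [coK [cK iK]] := bodyK.
have mK := compact_measurable2 coK; have bK := compact_bounded2 coK.
have V0 := vol2_gt0 mK bK iK; set V := vol2 K in V0.
(* Here [(3 / 2) ^+ 2 * al] is exactly [V / 2], so the contradiction rests on the strict bound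
   [q < 3 / 2] below. *)
pose al := 2 / 9 * V.
have al0 : 0 < al by rewrite /al; lra.
have al2 : 2 * al < V by rewrite /al; lra.
have [u [v [d1 [d2 [f1 [g1 [f2 [g2 [uv d12 e1 e2 [fg1 fg2 ch1 ch2 mid]]]]]]]]]] :=
  exists_isosceles_slab bodyK al0 al2.
have u0 := orthonormal_neq0 uv.
have uN0 : - u != 0 by rewrite oppr_eq0.
have -> : 4 / 9 = 2 / V * al :> R by rewrite /al; field; rewrite gt_eqF.
pose m := dot2 u c.
have refl d : cap K u d = cap K (- u) (d - 2 * m) by exact: cap_point_refl.
have e2' : cap K u (2 * m - d2) = al by rewrite refl -e2; congr cap; ring.
have strict d e : d < e -> cap K u d = al -> cap K u e = al -> False.
  move=> de cd ce.
  have [x Kx xd] : exists2 x, K x & dot2 u x < d.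
    apply: contrapT => nex; have : cap K u d = 0; last by rewrite cd; clear - al0; lra.
    rewrite -(vol2_line0 d mK bK u0) /cap; congr vol2; apply/seteqP; split => x.
      move=> [Kx xd]; split => //=; apply/eqP; rewrite eq_le xd /= leNgt.
      by apply/negP => lt; apply: nex; exists x.
    by move=> [Kx /= xd]; split => //; rewrite /halfspace2 /= xd.
  have [y Ky ey] : exists2 y, K y & e < dot2 u y.
    apply: contrapT => nex; have : cap K u e = V; last by rewrite ce /al; clear - V0; lra.
    rewrite /cap; congr vol2; apply/setIidPl => y Ky; rewrite /halfspace2 /= leNgt.
    by apply/negP => lt; apply: nex; exists y.
  by have := cap_lt bodyK u0 de Kx Ky xd ey; rewrite cd ce ltxx.
(* The reflected second cap and the first one have the same direction and area, hence the same
   level: the slab is centred at [c]. *)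
have dd : d1 + d2 = 2 * m.
  case: (ltgtP d1 (2 * m - d2)) => [lt|gt|->]; last by ring.
    by case: (strict _ _ lt e1 e2').
  by case: (strict _ _ gt e2' e1).
have half : cap K u m = V / 2.
  have := refl m; have := cap_opp m mK bK u0; rewrite -/V.
  have -> : m - 2 * m = - m by ring.
  by move=> E1 E2; clear - E1 E2; lra.
have dep w (a b : R) : w != 0 -> a < b -> cap K w a = al -> cap K w ((a + b) / 2) = V / 2 ->
    forall x, K x -> a - dot2 w x <= b - a.
  move=> w0 ab ea eb x Kx; rewrite leNgt; apply/negP => lt.
  have xa : dot2 w x < a by clear - ab lt; lra.
  have am : a <= (a + b) / 2 by clear - ab; lra.
  have := cap_homothety_le mK bK cK Kx xa am; rewrite ea eb.
  set q := _ / (_ - _).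
  have q1 : q < 3 / 2 by rewrite /q ltr_pdivrMr; clear - ab lt; lra.
  have q0 : 0 <= q by rewrite /q divr_ge0; clear - ab lt; lra.
  have : q ^+ 2 * al < (3 / 2) ^+ 2 * al.
    by rewrite ltr_pM2r// ltr_sqr// nnegrE; clear; lra.
  by rewrite /al; clear - V0; lra.
apply: (isosceles_slab_fold bodyK uv d12 e1 e2 ch1 ch2 mid).
  by apply: dep => //; rewrite dd -half; congr cap; field.
move=> x Kx; have d21 : - d2 < - d1 by clear - d12; lra.
have := dep (- u) (- d2) (- d1) uN0 d21 e2.
have -> : (- d2 + - d1) / 2 = m - 2 * m by clear - dd; lra.
by rewrite -refl half => /(_ erefl x Kx); rewrite dot2N => h; clear - h; lra.
Qed.

End Folding.

(** * Thin parallelograms *)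

Section Parallelogram.
Context {R : realType}.
Implicit Types (K : set (R * R)) (a : R * R).

Lemma is_fold_scale K a (c k : R) : 0 < k ->
  is_fold K (k * a.1, k * a.2) (k * c) -> is_fold K a c.
Proof.
move=> k0 h _ [x [Kx xc] <-].
have -> : refl2 a c x = refl2 (k * a.1, k * a.2) (k * c) x.
  have k0' : k != 0 by rewrite gt_eqF.
  have E (p : R) : 2 * (dot2 (k * a.1, k * a.2) x - k * c) /
      dot2 (k * a.1, k * a.2) (k * a.1, k * a.2) * (k * p) =
      2 * (dot2 a x - c) / dot2 a a * p.
    have -> : dot2 (k * a.1, k * a.2) x - k * c = k * (dot2 a x - c).
      by rewrite /dot2 /=; ring.
    have -> : dot2 (k * a.1, k * a.2) (k * a.1, k * a.2) = k * k * dot2 a a.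
      by rewrite /dot2 /=; ring.
    rewrite !invfM.
    have -> : 2 * (k * (dot2 a x - c)) * (k^-1 / k * (dot2 a a)^-1) * (k * p) =
      (k / k) * (k / k) * (2 * (dot2 a x - c) * (dot2 a a)^-1 * p) by ring.
    by rewrite divff// !mul1r.
  by rewrite /refl2 /= !E.
apply: h; exists x => //; split => //; move: xc; rewrite /halfspace2 /= /dot2 /= => xc.
by rewrite -!mulrA -mulrDr ler_pM2l.
Qed.

(** Conjugating the fold by the point reflection gives the fold from the opposite side; this allows
    the sign of [a] to be chosen. *)
Lemma is_fold_point_refl K z a (c : R) : (forall x, K x -> K (point_refl z x)) ->
  is_fold K a c -> is_fold K (- a) (c - 2 * dot2 a z).
Proof.
move=> Kz h _ [x [Kx xc] <-].
have zz y : point_refl z (point_refl z y) = y.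
  by rewrite /point_refl /= [RHS]surjective_pairing; congr pair; ring.
have -> : refl2 (- a) (c - 2 * dot2 a z) x = point_refl z (refl2 a c (point_refl z x)).
  have -> : refl2 (- a) (c - 2 * dot2 a z) x =
      (x.1 - 2 * (dot2 a x + c - 2 * dot2 a z) / dot2 a a * a.1,
       x.2 - 2 * (dot2 a x + c - 2 * dot2 a z) / dot2 a a * a.2).
    have E1 : dot2 (- a) x - (c - 2 * dot2 a z) = - (dot2 a x + c - 2 * dot2 a z).
      by rewrite dot2N; ring.
    have E2 : dot2 (- a) (- a) = dot2 a a by rewrite /dot2 /=; ring.
    by rewrite /refl2 E1 E2 /=; congr pair; ring.
  have E3 : dot2 a (point_refl z x) - c = - (dot2 a x + c - 2 * dot2 a z).
    by rewrite /dot2 /point_refl /=; ring.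
  by rewrite /refl2 E3 /point_refl /=; congr pair; ring.
apply: (Kz _ _); apply: h; exists (point_refl z x) => //; split; first exact: Kz.
move: xc; rewrite /halfspace2 /= dot2N /point_refl /dot2 /=; lra.
Qed.

Definition para (s e : R) : set (R * R) := trapezoid 0 e 0 (s / e) 1 (s / e).

Variables (s e : R).
Local Notation P := (para s e).

(* As [e] tends to [0], the last condition becomes [0 < 1 - 3 s + s^2], that is,
   [s < (3 - sqrt 5) / 2]. *)
Definition thin_para := [/\ 3 / 10 < s, s < 2 / 5, 0 < e, e <= 1 / 10 &
  (1 / 2 + 8 * e ^+ 2) * (1 + s - s ^+ 2) <= 1 - s].

Let mP : measurable P. Proof. exact: measurable_trapezoid. Qed.
Let bP : bounded2 P. Proof. exact: bounded_trapezoid. Qed.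

Lemma thin_para_facts : thin_para -> [/\ 0 < s, 0 <= s, 0 <= e & e ^+ 2 <= 1 / 100].
Proof.
move=> [s_gt _ e_gt0 e_le _].
have s0 : 0 < s by apply: lt_trans s_gt; rewrite divr_gt0.
split => //; [exact: ltW|exact: ltW|].
have -> : 1 / 100 = (1 / 10) ^+ 2 :> R by rewrite expr_div_n expr1n -natrX.
by rewrite ler_sqr ?nnegrE ?divr_ge0// ltW.
Qed.

(** The side conditions are multiplied by [e] to clear denominators. *)
Lemma paraE x : thin_para ->
  P x <-> [/\ 0 <= x.2, x.2 <= e, s * x.2 <= e * x.1 & e * x.1 <= e + s * x.2].
Proof.
move=> th; have [s_gt s_half e_gt0 e_le e_small] := th.
have [s0 s_ge0 e_ge0 e2] := thin_para_facts th.
have se (y : R) : s / e * y * e = s * y by field; rewrite gt_eqF.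
have h1 : (0 + s / e * x.2 <= x.1) = (s * x.2 <= e * x.1).
  by rewrite -(ler_pM2r e_gt0) mulrDl se mul0r add0r [x.1 * _]mulrC.
have h2 : (x.1 <= 1 + s / e * x.2) = (e * x.1 <= e + s * x.2).
  by rewrite -(ler_pM2r e_gt0) mulrDl se mul1r [x.1 * _]mulrC.
rewrite /para /trapezoid /= h1 h2; split; first by case=> /andP[? ?] /andP[].
by case=> -> -> -> ->.
Qed.

Lemma vol2_para : thin_para -> vol2 P = e.
Proof.
move=> [_ _ e_gt0 _ _].
rewrite vol2_trapezoid//; last 2 first.
- by rewrite !mulr0 !addr0 ler01.
- by rewrite lerD2r ler01.
by rewrite !subr0 subrr mul0r mul0r addr0 mulr1.
Qed.

(** Since [P] has area [e], a cap of area [e * (1 - s) / 2] contributes [1 - s] to the folding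
    symmetry. Caps are bounded by enclosing trapezoids standing on the base line. *)
Lemma cap_para_le a c (y1 a0 a1 b0 b1 : R) : 0 < y1 ->
  a0 <= b0 -> a0 + a1 * y1 <= b0 + b1 * y1 ->
  (forall x, P x -> dot2 a x <= c -> trapezoid 0 y1 a0 a1 b0 b1 x) ->
  y1 * ((b0 - a0) + (b1 - a1) * y1 / 2) <= e * (1 - s) / 2 ->
  cap P a c <= e * (1 - s) / 2.
Proof.
move=> y10 h0 h1 sub; apply: le_trans.
have := @vol2_trapezoid R 0 y1 a0 a1 b0 b1 y10; rewrite !mulr0 !addr0 subr0 add0r.
move=> /(_ h0 h1) <-; apply: le_vol2.
- by apply: measurableI => //; exact: measurable_halfspace2.
- exact: measurable_trapezoid.
- exact: bounded_trapezoid.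
- by move=> x [Px xc]; exact: sub.
Qed.

(** Either the cap misses the interior of the right part of [P] and is small, or it contains both
    left vertices; then the fold line must be vertical with [c <= 1 / 2]. *)
Lemma cap_para_near_vertical (q c : R) : thin_para -> `|q| <= 4 * e ->
  is_fold P (1, q) c -> cap P (1, q) c <= e * (1 - s) / 2.
Proof.
move=> th; have [s_gt s_half e_gt0 e_le e_small] := th.
have [s0 s_ge0 e_ge0 e2] := thin_para_facts th.
rewrite ler_norml => /andP[q1 q2] val.
have [c0|c0] := leP c 0.
  apply: (@cap_para_le _ _ e 0 0 (4 * e ^+ 2) 0) => //; rewrite ?mul0r ?mulr0 ?addr0 ?subr0.
  - by rewrite mulr_ge0// sqr_ge0.
  - by rewrite mulr_ge0// sqr_ge0.
  - move=> x /(paraE _ th)[y0 ye h1 h2]; rewrite /dot2 /= mul1r => xc.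
    split; first by rewrite y0.
    rewrite !mul0r !addr0; apply/andP; split.
      by rewrite -(ler_pM2l e_gt0) mulr0; apply: le_trans h1; exact: mulr_ge0.
    have : q * x.2 >= - (4 * e) * e by nra.
    nra.
  - by rewrite mul0r mul0r addr0 -[e * (1 - s) / 2]mulrA ler_pM2l//; lra.
(* Here the line passes to the left of the vertex [(s, e)] or through it, and the cap has area at
   most [e * (s / 2 + 4 * e ^+ 2)]. *)
have [cs|cs] := leP c (s + q * e).
  apply: (@cap_para_le _ _ e 0 (s / e) (s + 4 * e ^+ 2) 0) => //.
  - by rewrite addr_ge0// ?mulr_ge0// ?sqr_ge0//; lra.
  - rewrite divfK ?gt_eqF// add0r mul0r addr0 lerDl mulr_ge0// sqr_ge0//.
  - move=> x Px; have [_ /andP[h1' _]] := Px; move: Px => /(paraE _ th)[y0 ye h1 h2].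
    rewrite /dot2 /= mul1r => xc.
    split; first by rewrite y0.
    rewrite h1' mul0r addr0 /=.
    have : q * (e - x.2) <= 4 * e * e.
      have : q * (e - x.2) <= 4 * e * (e - x.2) by rewrite ler_wpM2r//; lra.
      have : 4 * e * (e - x.2) <= 4 * e * e.
        by rewrite ler_pM2l ?mulr_gt0//; lra.
      by move=> A B; apply: le_trans B A.
    nra.
  - rewrite -[e * (1 - s) / 2]mulrA ler_pM2l// !sub0r subr0 mulNr divfK ?gt_eqF//.
    lra.
(* Both left vertices are folded. The image of [(0, 0)] stays above the base only if [0 <= q], that
   of [(s, e)] below the top only if [q <= 0]. *)
have q2p : 0 < 1 + q ^+ 2 by rewrite ltr_pwDl// sqr_ge0.
have dd : dot2 (1, q) (1, q) = 1 + q ^+ 2 by rewrite /dot2 /= mulr1 expr2.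
have PO : P (0, 0) by apply/(paraE _ th); split => /=; rewrite ?mulr0 ?addr0.
have PV : P (s, e).
  by apply/(paraE _ th); split => //=; [rewrite mulrC|rewrite mulrC lerDr].
have /(paraE _ th)[] : P (refl2 (1, q) c (0, 0)).
  by apply: val; exists (0, 0) => //; split => //; rewrite /halfspace2 /= /dot2 /= !mulr0 addr0 ltW.
have -> : refl2 (1, q) c (0, 0) = (2 * c / (1 + q ^+ 2), 2 * c * q / (1 + q ^+ 2)).
  rewrite /refl2 dd /dot2 /=; congr pair; ring.
rewrite /= => A1 _ _ A2.
have /(paraE _ th)[] : P (refl2 (1, q) c (s, e)).
  by apply: val; exists (s, e) => //; split => //; rewrite /halfspace2 /= /dot2 /= mul1r ltW.
have -> : refl2 (1, q) c (s, e) = (s + 2 * (c - s - q * e) / (1 + q ^+ 2),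
    e + 2 * (c - s - q * e) * q / (1 + q ^+ 2)).
  rewrite /refl2 dd /dot2 /=; congr pair; ring.
rewrite /= => _ B1 _ _.
have q_ge0 : 0 <= q by move: A1; rewrite pmulr_lge0 ?invr_gt0// pmulr_rge0//; lra.
have q_le0 : q <= 0.
  move: B1; rewrite gerDl pmulr_lle0 ?invr_gt0// pmulr_rle0//; lra.
have q0 : q = 0 by apply/eqP; rewrite eq_le q_le0.
rewrite q0 expr0n /= addr0 divr1 mulr0 mul0r mulr0 addr0 in A2.
have c12 : c <= 1 / 2 by move: A2; rewrite -[X in _ <= X]mulr1 ler_pM2l//; lra.
apply: (@cap_para_le _ _ e 0 (s / e) (1 / 2) 0) => //.
- by rewrite divfK ?gt_eqF// add0r mul0r addr0; lra.
- move=> x Px; have [yy /andP[h1' _]] := Px; rewrite /dot2 /= q0 mul1r mul0r addr0 => xc.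
  by split => //; rewrite h1' mul0r addr0 /=; lra.
- rewrite -[e * (1 - s) / 2]mulrA ler_pM2l// sub0r subr0 mulNr divfK ?gt_eqF//; lra.
Qed.

Lemma cap_para_line0 a c : thin_para -> (forall x, P x -> dot2 a x <= c -> x.2 = 0) ->
  cap P a c <= e * (1 - s) / 2.
Proof.
move=> th; have [s_gt s_half e_gt0 e_le e_small] := th.
have [s0 s_ge0 e_ge0 e2] := thin_para_facts th.
move=> h; have u0 : ((0, 1) : R * R) != 0.
  by apply/eqP => -[] /eqP; rewrite oner_eq0.
apply: (@le_trans _ _ 0); last by rewrite divr_ge0// mulr_ge0 ?(ltW e_gt0)//; lra.
rewrite -(vol2_line0 0 mP bP u0); apply: le_vol2.
- by apply: measurableI => //; exact: measurable_halfspace2.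
- by apply: measurableI => //; exact: measurable_line.
- by apply: bounded2S bP; exact: subIsetl.
- by move=> x [Px xc]; split => //=; rewrite /dot2 /= mul0r mul1r add0r; exact: h.
Qed.

(* A cap beyond an almost horizontal line meeting the base in length [w <= 1] is, in units of
   [e], a triangle of area [w^2 / (2 d)], where [d + s] is the inverse slope of the line;
   [l] bounds the height of the line above the vertex [(1, 0)]. *)
Lemma triangle_area_le (w d l : R) : 0 <= s -> 0 < d -> 0 <= w -> w <= 1 -> w <= d ->
  w <= l * (d + s) -> l <= 1 - s -> 0 < l -> l * (1 + s - s ^+ 2) <= 1 - s ->
  w ^+ 2 <= (1 - s) * d.
Proof.
move=> s0 d0 w0 w1 wd wl l1 l0 H.
have [ws|ws] := leP w (1 - s); first by rewrite expr2; apply: ler_pM.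
have s1 : 0 < s by lra.
have l1' : 0 <= 1 - s - l by lra.
(* The difference of the two sides is concave in [w]. The identity compares it with its linear
   interpolation between [w = 1 - s] and [w = 1], where its values are [(1 - s) * (1 - s - l)] and
   [1 - s - l * (1 + s - s ^+ 2)]. *)
have key : l * w ^+ 2 <= (1 - s) * (w - l * s).
  rewrite -subr_ge0 -(pmulr_rge0 _ s1).
  have -> : s * ((1 - s) * (w - l * s) - l * w ^+ 2) =
    (1 - w) * ((1 - s) * (1 - s - l)) +
    (w - (1 - s)) * (1 - s - l * (1 + s - s ^+ 2)) +
    l * s * ((1 - w) * (w - (1 - s))) by ring.
  have s1' : 0 <= 1 - s by lra.
  by rewrite !addr_ge0// !mulr_ge0//; lra.
rewrite -(ler_pM2l l0); apply: le_trans key _.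
have -> : l * ((1 - s) * d) = (1 - s) * (l * d) by ring.
by rewrite ler_pM2l; lra.
Qed.

Lemma cap_para_near_horizontal (p c : R) : thin_para -> `|p| <= 4 * e ->
  is_fold P (p, 1) c -> cap P (p, 1) c <= e * (1 - s) / 2.
Proof.
move=> th; have [s_gt s_half e_gt0 e_le e_small] := th.
have [s0 s_ge0 e_ge0 e2] := thin_para_facts th.
rewrite ler_norml => /andP[p1 p2] val.
have pp : p ^+ 2 <= 16 * e ^+ 2 by nra.
have p2p : 0 < 1 + p ^+ 2 by rewrite ltr_pwDl// sqr_ge0.
have dd : dot2 (p, 1) (p, 1) = 1 + p ^+ 2 by rewrite /dot2 /= mulr1 expr2 addrC.
have PO : P (0, 0) by apply/(paraE _ th); split => /=; rewrite ?mulr0 ?addr0.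
have PB : P (1, 0).
  by apply/(paraE _ th); split => /=; rewrite ?mulr0 ?addr0 ?mulr1.
(* Otherwise [(0, 0)] would be folded almost vertically upwards, across the slanted left side. *)
have c0 : c <= 0.
  rewrite leNgt; apply/negP => c0.
  have /(paraE _ th)[] : P (refl2 (p, 1) c (0, 0)).
    apply: val; exists (0, 0) => //; split => //.
    by rewrite /halfspace2 /= /dot2 /= !mulr0 addr0 ltW.
  have -> : refl2 (p, 1) c (0, 0) = (2 * c / (1 + p ^+ 2) * p, 2 * c / (1 + p ^+ 2)).
    rewrite /refl2 dd /dot2 /=; congr pair; ring.
  rewrite /= => _ _ A1 _.
  have t0 : 0 < 2 * c / (1 + p ^+ 2) by rewrite divr_gt0// mulr_gt0.
  move: A1; rewrite [e * _]mulrCA [s * _]mulrC ler_pM2l//; nra.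
have [p0|p0] := leP 0 p.
  apply: (cap_para_line0 th) => x /(paraE _ th)[y0 ye h1 h2]; rewrite /dot2 /= mul1r => xc.
  have x0 : 0 <= x.1.
    by rewrite -(pmulr_rge0 _ e_gt0); apply: le_trans h1; exact: mulr_ge0.
  have : 0 <= p * x.1 by rewrite mulr_ge0.
  by move=> ?; apply/eqP; rewrite eq_le y0 andbT; lra.
pose n := - p.
have n0 : 0 < n by rewrite /n; lra.
(* The vertex [(1, 0)] must be folded to height at most [e], so the line passes above it at little
   more than half the height of [P]. *)
have lam_le : c + n <= e * (1 / 2 + 8 * e ^+ 2).
  have [cp|cp] := leP c p.
    by apply: (@le_trans _ _ 0); [rewrite /n; lra|rewrite mulr_ge0 ?(ltW e_gt0)//; lra].
  have /(paraE _ th)[] : P (refl2 (p, 1) c (1, 0)).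
    apply: val; exists (1, 0) => //; split => //.
    by rewrite /halfspace2 /= /dot2 /= mulr0 addr0 mulr1 ltW.
  have -> : refl2 (p, 1) c (1, 0) =
      (1 + 2 * (c - p) / (1 + p ^+ 2) * p, 2 * (c - p) / (1 + p ^+ 2)).
    rewrite /refl2 dd /dot2 /=; congr pair; ring.
  rewrite /= => _ + _ _; rewrite ler_pdivrMr// /n => h.
  have : e * (1 + p ^+ 2) <= e * (1 + 16 * e ^+ 2) by rewrite ler_pM2l//; lra.
  lra.
pose l := 1 / 2 + 8 * e ^+ 2.
(* In units of [e], the line has height [lam] above [(1, 0)], truncated at [0], and inverse slope
   [j]; it cuts the length [j * lam] off the base. *)
pose lam := Num.max ((c + n) / e) 0.
pose j := e / n.
have j0 : 0 < j by rewrite divr_gt0.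
have ln : l <= 58 / 100 by rewrite /l; lra.
have l_half : 1 / 2 <= l by rewrite /l; have := sqr_ge0 e; lra.
have lam0 : 0 <= lam by rewrite le_max lexx orbT.
have laml : lam <= l.
  by rewrite ge_max ler_pdivrMr// [_ * e]mulrC lam_le /=; lra.
have jn : j * n = e by rewrite /j divfK// gt_eqF.
have w1 : j * lam <= 1.
  rewrite -(ler_pM2r n0) mul1r mulrAC jn /lam maxr_pMr ?(ltW e_gt0)// mulr0.
  by rewrite mulrCA divff ?gt_eqF// mulr1 ge_max; lra.
have cl (x : R * R) : P x -> dot2 (p, 1) x <= c -> 1 - j * lam + j / e * x.2 <= x.1.
  move=> _; rewrite /dot2 /= mul1r => xc.
  have : c + n <= e * lam.
    by rewrite -ler_pdivrMl// mulrC le_max lexx.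
  have : x.2 - c <= n * x.1 by rewrite /n; lra.
  move=> h1 h2; rewrite -(ler_pM2l n0); apply: le_trans h1.
  have -> : n * (1 - j * lam + j / e * x.2) = n - (j * n) * lam + (j * n) / e * x.2 by ring.
  rewrite jn divff ?gt_eqF//; lra.
(* In the first case a trapezoid of full height [e] encloses the cap and suffices; otherwise the
   line meets the right side below the top, and the cap lies in a triangle. *)
have [wd|wd] := leP (j - s) (j * lam).
  apply: (@cap_para_le _ _ e (1 - j * lam) (j / e) 1 (s / e)) => //.
  - by rewrite gerBl mulr_ge0// ltW.
  - by rewrite !divfK ?gt_eqF//; lra.
  - move=> x Px xc; have [yy /andP[_ h2']] := Px.
    by split => //; rewrite h2' andbT; exact: cl.
  - rewrite -[e * (1 - s) / 2]mulrA ler_pM2l//.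
    have -> : (s / e - j / e) * e = s - j by field; rewrite gt_eqF.
    have jb : j * (1 - l) <= s by nra.
    have : j * lam <= j * l by rewrite ler_pM2l.
    have jj : j <= 1 by nra.
    have : j * (l - 1 / 2) <= 8 / 100.
      by apply: (@le_trans _ _ (1 * (l - 1 / 2))); [rewrite ler_wpM2r; lra|rewrite /l; lra].
    lra.
have djs : 0 < j - s by apply: le_lt_trans wd; rewrite mulr_ge0// ltW.
have [w0|w0] := leP (j * lam) 0.
  apply: (cap_para_line0 th) => x Px xc; have := cl _ Px xc.
  move: Px => /(paraE _ th)[y0 ye h1 h2] h3.
  have w00 : j * lam = 0 by apply/eqP; rewrite eq_le w0 mulr_ge0// ltW.
  move: h3; rewrite w00 subr0 -(ler_pM2l e_gt0) mulrDr mulr1.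
  have -> : e * (j / e * x.2) = j * x.2 by field; rewrite gt_eqF.
  move=> h3; apply/eqP; rewrite eq_le y0 andbT leNgt; apply/negP => y0'.
  have : 0 < (j - s) * x.2 by rewrite mulr_gt0.
  by lra.
(* Height of the apex of the triangle in units of [e]. *)
pose Y := j * lam / (j - s).
have Y0 : 0 < Y by rewrite divr_gt0.
have YE : (j - s) * Y = j * lam by rewrite /Y mulrC divfK// gt_eqF.
have Ye : 0 < e * Y by rewrite mulr_gt0.
have jse (z : R) : (s / e - j / e) * (e * z) = - ((j - s) * z).
  by field; rewrite gt_eqF.
apply: (@cap_para_le _ _ (e * Y) (1 - j * lam) (j / e) 1 (s / e)) => //.
- by rewrite gerBl ltW.
- by have := jse Y; rewrite YE mulrBl; lra.
- move=> x Px xc; have [/andP[y0 _] /andP[_ h2']] := Px; have h := cl _ Px xc.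
  split; last by rewrite h2' andbT.
  rewrite y0 /= -(ler_pM2r djs).
  have -> : e * Y * (j - s) = e * ((j - s) * Y) by ring.
  rewrite YE.
  have hh : e * (1 - j * lam + j / e * x.2) <= e * (1 + s / e * x.2).
    by rewrite ler_pM2l//; exact: le_trans h h2'.
  have E1 : e * (j / e * x.2) = j * x.2 by field; rewrite gt_eqF.
  have E2 : e * (s / e * x.2) = s * x.2 by field; rewrite gt_eqF.
  rewrite !mulrDr E1 E2 in hh.
  by clear - hh; lra.
- rewrite jse YE.
  have -> : e * Y * (1 - (1 - j * lam) + - (j * lam) / 2) = e * (Y * (j * lam)) / 2 by field.
  rewrite ler_pM2r// ler_pM2l// /Y mulrAC ler_pdivrMr// -expr2.
  apply: (@triangle_area_le _ _ l) => //; [exact: ltW|exact: ltW| |lra|lra].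
  by rewrite subrK mulrC ler_pM2r.
Qed.

(** A fold moves no point vertically by more than the height [e] of [P]. This confines the cap to a
    strip whose horizontal width is at most [(1 - s) / 2]. *)
Lemma cap_para_oblique a c : thin_para -> 0 < a.1 -> a.2 != 0 ->
  e * dot2 a a <= (1 - s) * (a.1 * `|a.2|) ->
  is_fold P a c -> cap P a c <= e * (1 - s) / 2.
Proof.
move=> th; have [s_gt s_half e_gt0 e_le e_small] := th.
have [s0 s_ge0 e_ge0 e2] := thin_para_facts th.
move=> a1 a2 h val.
have a2' : 0 < `|a.2| by rewrite normr_gt0.
have aa : 0 < dot2 a a.
  by rewrite /dot2 ltr_pwDl ?mulr_gt0// -expr2 sqr_ge0.
pose H := e * dot2 a a / (2 * `|a.2|).
have H0 : 0 < H by rewrite divr_gt0 ?mulr_gt0.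
apply: (@cap_para_le _ _ e ((c - H) / a.1) (- (a.2 / a.1)) (c / a.1) (- (a.2 / a.1))) => //.
- by rewrite ler_pM2r ?invr_gt0//; lra.
- by rewrite lerD2r ler_pM2r ?invr_gt0//; lra.
- move=> x Px xc; have [yy _] := Px.
  have /(paraE _ th)[r1 r2 _ _] : P (refl2 a c x) by apply: val; exists x.
  have [/andP[y0 y1] _] := Px.
  have dep : c - dot2 a x <= H.
    rewrite /H ler_pdivlMr ?mulr_gt0//.
    have := r2; have := r1; rewrite /refl2 /=.
    set k := 2 * (dot2 a x - c) / dot2 a a => k1 k2.
    have : `|k * a.2| <= e by rewrite ler_norml; apply/andP; split; lra.
    rewrite normrM /k !normrM (gtr0_norm (_ : 0 < (dot2 a a)^-1)) ?invr_gt0//.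
    rewrite (ger0_norm (_ : 0 <= 2))// ler0_norm; last lra.
    rewrite mulrAC ler_pdivrMr//; lra.
  split => //.
  have E (z : R) : z / a.1 + - (a.2 / a.1) * x.2 = (z - a.2 * x.2) / a.1 by ring.
  rewrite !E ler_pdivrMr// ler_pdivlMr//.
  by move: dep xc; rewrite /dot2 => ? ?; apply/andP; split; lra.
- rewrite subrr mul0r mul0r addr0 -mulrBl -[e * (1 - s) / 2]mulrA ler_pM2l//.
  rewrite opprB addrC subrK ler_pdivrMr// /H ler_pdivrMr ?mulr_gt0//.
  lra.
Qed.

Let z : R * R := ((1 + s) / 2, e / 2).

Lemma para_point_refl x : thin_para -> P x -> P (point_refl z x).
Proof.
move=> th; have [s_gt s_half e_gt0 e_le e_small] := th.
have [s0 s_ge0 e_ge0 e2] := thin_para_facts th.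
move=> /(paraE _ th)[h1 h2 h3 h4]; apply/(paraE _ th); rewrite /point_refl /z /=.
by split; lra.
Qed.

(** If [a] is not oblique, then [1 / 2 * |a.1| * |a.2| < e * dot2 a a], and [dot2 a a] is at most
    twice the square of the larger coordinate; so the smaller coordinate is at most [4 * e] times
    the larger. *)
Lemma cap_para_fold a c : thin_para -> a != 0 -> is_fold P a c -> cap P a c <= e * (1 - s) / 2.
Proof.
move=> th; have [s_gt s_half e_gt0 e_le e_small] := th.
have [s0 s_ge0 e_ge0 e2] := thin_para_facts th.
move=> a0 val.
have scale (b : R * R) d k : 0 < k ->
    cap P (k * b.1, k * b.2) (k * d) <= e * (1 - s) / 2 -> cap P b d <= e * (1 - s) / 2.
  by move=> k0; rewrite cap_scale.
have norm (b : R * R) d k : 0 < k -> is_fold P b d ->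
    is_fold P (k * b.1, k * b.2) (k * d).
  move=> k0 h; apply: (@is_fold_scale _ _ _ k^-1); first by rewrite invr_gt0.
  by rewrite /= !mulKf ?gt_eqF// -surjective_pairing.
have sym b d : cap P (- b) (d - 2 * dot2 b z) <= e * (1 - s) / 2 ->
    cap P b d <= e * (1 - s) / 2.
  by rewrite -(cap_point_refl _ _ mP bP (fun x => @para_point_refl x th)).
have symv b d : is_fold P b d -> is_fold P (- b) (d - 2 * dot2 b z).
  by apply: is_fold_point_refl; by move=> x; exact: para_point_refl.
have vert (b : R * R) d : 0 < b.1 -> `|b.2| <= 4 * e * b.1 -> is_fold P b d ->
    cap P b d <= e * (1 - s) / 2.
  move=> b1 b2 h; have k0 : 0 < b.1^-1 by rewrite invr_gt0.
  apply: (scale _ _ _ k0); have := norm _ _ _ k0 h.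
  rewrite mulVf ?gt_eqF//; apply: (cap_para_near_vertical th).
  by rewrite normrM gtr0_norm// mulrC ler_pdivrMr.
have hori (b : R * R) d : 0 < b.2 -> `|b.1| <= 4 * e * b.2 -> is_fold P b d ->
    cap P b d <= e * (1 - s) / 2.
  move=> b2 b1 h; have k0 : 0 < b.2^-1 by rewrite invr_gt0.
  apply: (scale _ _ _ k0); have := norm _ _ _ k0 h.
  rewrite mulVf ?gt_eqF//; apply: (cap_para_near_horizontal th).
  by rewrite normrM gtr0_norm// mulrC ler_pdivrMr.
have n1 := normr_ge0 a.1; have n2 := normr_ge0 a.2.
have aE : dot2 a a = `|a.1| ^+ 2 + `|a.2| ^+ 2.
  by rewrite !real_normK ?num_real// /dot2 -!expr2.
have [obl|nobl] := leP (e * dot2 a a) ((1 - s) * (`|a.1| * `|a.2|)).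
  have aa : 0 < dot2 a a.
    rewrite aE lt_neqAle addr_ge0 ?sqr_ge0// andbT eq_sym.
    rewrite paddr_eq0 ?sqr_ge0// !sqrf_eq0 !normr_eq0.
    by apply: contra a0 => /andP[/eqP x1 /eqP x2]; rewrite (surjective_pairing a) x1 x2.
  have pos : 0 < `|a.1| * `|a.2|.
    have h1 : 0 < (1 - s) * (`|a.1| * `|a.2|) by apply: lt_le_trans obl; rewrite mulr_gt0.
    by move: h1; rewrite pmulr_rgt0//; lra.
  have a1n : a.1 != 0 by apply/eqP => x1; move: pos; rewrite x1 normr0 mul0r ltxx.
  have a2n : a.2 != 0 by apply/eqP => x2; move: pos; rewrite x2 normr0 mulr0 ltxx.
  have [a1|a1] := ltP 0 a.1.
    by apply: (cap_para_oblique th) => //; rewrite -[X in _ <= _ * (X * _)]gtr0_norm.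
  have a1' : a.1 < 0 by rewrite lt_neqAle a1n.
  apply: sym; apply: (cap_para_oblique th) => /=; [lra|by rewrite oppr_eq0| |exact: symv].
  have -> : dot2 (- a) (- a) = dot2 a a by rewrite /dot2 /=; ring.
  by rewrite normrN -(ltr0_norm a1').
have hm : 1 / 2 * (`|a.1| * `|a.2|) <= (1 - s) * (`|a.1| * `|a.2|).
  by rewrite ler_wpM2r ?mulr_ge0//; lra.
have [le12|lt21] := leP `|a.1| `|a.2|.
  have a2n : 0 < `|a.2|.
    rewrite lt_neqAle n2 andbT eq_sym; apply/eqP => x2.
    have x1 : `|a.1| = 0 by apply/eqP; rewrite eq_le n1 andbT -x2.
    by move: a0; rewrite (surjective_pairing a) (normr0_eq0 x1) (normr0_eq0 x2) eqxx.
  have b12 : `|a.1| <= 4 * e * `|a.2|.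
    rewrite -(ler_pM2r a2n).
    have : e * dot2 a a <= e * (2 * (`|a.2| * `|a.2|)).
      by rewrite ler_pM2l// aE; nra.
    by move=> A; clear - A nobl hm; lra.
  have [a2|a2] := ltP 0 a.2; first by apply: hori => //; rewrite -[X in _ <= _ * X]gtr0_norm.
  have a2' : a.2 < 0 by rewrite lt_neqAle a2 andbT -normr_eq0 gt_eqF.
  apply: sym; apply: hori => /=; [lra| |exact: symv].
  by rewrite normrN -(ltr0_norm a2').
have a1n : 0 < `|a.1| by apply: le_lt_trans lt21.
have b21 : `|a.2| <= 4 * e * `|a.1|.
  rewrite -(ler_pM2r a1n).
  have : e * dot2 a a <= e * (2 * (`|a.1| * `|a.1|)).
    by rewrite ler_pM2l// aE; nra.
  by move=> A; clear - A nobl hm; lra.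
have [a1|a1] := ltP 0 a.1; first by apply: vert => //; rewrite -[X in _ <= _ * X]gtr0_norm.
have a1' : a.1 < 0 by rewrite lt_neqAle a1 andbT -normr_eq0 gt_eqF.
apply: sym; apply: vert => /=; [lra| |exact: symv].
by rewrite normrN -(ltr0_norm a1').
Qed.

End Parallelogram.

(** * Folding symmetry of thin parallelograms *)

Section ThinPara.
Context {R : realType}.
Variables (s e : R).
Hypothesis th : thin_para s e.
Local Notation P := (para s e).

Let mP : measurable P. Proof. exact: measurable_trapezoid. Qed.
Let bP : bounded2 P. Proof. exact: bounded_trapezoid. Qed.

Lemma para_convex_body2 : convex_body2 P.
Proof.
have [s_gt s_half e_gt0 e_le e_small] := th.
have [s0 s_ge0 e_ge0 e2] := thin_para_facts th.
split; last split.
- have [M PM] := bP.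
  apply: (@subclosed_compact _ _ (`[- M, M] `*` `[- M, M])).
  + exact: closed_trapezoid.
  + by apply: compact_setX; exact: segment_compact.
  + by move=> x /PM[]; rewrite !ler_norml => h1 h2; split; rewrite /= in_itv.
- move=> x y /(paraE _ th)[h1 h2 h3 h4] /(paraE _ th)[k1 k2 k3 k4] t t0 t1.
  have t1' : 0 <= 1 - t by lra.
  have cc (a b c d : R) : a <= b -> c <= d -> t * a + (1 - t) * c <= t * b + (1 - t) * d.
    by move=> ab cd; apply: lerD; apply: ler_wpM2l.
  apply/(paraE _ th) => /=; split.
  + by have := cc _ _ _ _ h1 k1; lra.
  + by have := cc _ _ _ _ h2 k2; lra.
  + by have := cc _ _ _ _ h3 k3; lra.
  + by have := cc _ _ _ _ h4 k4; lra.
- exists (1 / 2, e / 2); exists (`]2 / 5, 1[%classic, `]0, e[%classic) => /=.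
    by split; apply: open_nbhs_nbhs; split; [exact: itv_open| |exact: itv_open| ];
      rewrite /= in_itv /=; apply/andP; split; lra.
  move=> [x y] [/=]; rewrite !in_itv /= => /andP[x1 x2] /andP[y1 y2].
  apply/(paraE _ th) => /=.
  have sy : 0 <= s * y by rewrite mulr_ge0// ltW.
  have sy' : s * y <= 2 / 5 * e by apply: ler_pM; lra.
  have ex : e * (2 / 5) <= e * x by rewrite ler_pM2l// ltW.
  have ex' : e * x <= e * 1 by rewrite ler_pM2l// ltW.
  by split; lra.
Qed.

Lemma para_centrally_symmetric2 : centrally_symmetric2 P.
Proof. by exists ((1 + s) / 2, e / 2) => x; exact: para_point_refl. Qed.

Lemma para_is_parallelogram2 : is_parallelogram2 P.
Proof.
have [_ _ e_gt0 _ _] := th.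
exists (0, 0), (1, 0), (s, e); split; first by rewrite /= mul1r mul0r subr0 gt_eqF.
apply/seteqP; split => [x Px|_ [r /= + [t /= + <-]]].
  have [/andP[y0 y1] /andP[x0 x1]] := Px.
  exists (x.1 - s / e * x.2).
    by rewrite /= in_itv /=; apply/andP; split; lra.
  exists (x.2 / e).
    by rewrite /= in_itv /= divr_ge0 ?ler_pdivrMr ?mul1r// ltW.
  rewrite [RHS]surjective_pairing /=; congr pair; first by ring.
  by field; rewrite gt_eqF.
rewrite !in_itv /= => /andP[r0 r1] /andP[t0 t1]; apply/(paraE _ th) => /=.
have et : 0 <= t * e by rewrite mulr_ge0// ltW.
have et1 : t * e <= 1 * e by rewrite ler_pM2r.
have er : 0 <= e * r by rewrite mulr_ge0// ltW.
have er1 : e * r <= e * 1 by rewrite ler_pM2l.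
by split; lra.
Qed.

(** The upper bound on folded caps is attained by the vertical line [x.1 = 1 / 2]. *)
Lemma sym_fold2_para : sym_fold2 P = 1 - s.
Proof.
have [s_gt s_half e_gt0 e_le e_small] := th.
have [s0 s_ge0 e_ge0 e2] := thin_para_facts th.
have u0 : ((1, 0) : R * R) != 0.
  by apply/eqP => -[] /eqP; rewrite oner_eq0.
have val : is_fold P (1, 0) (1 / 2).
  move=> _ [x [/(paraE _ th)[h1 h2 h3 h4]] + <-].
  rewrite /halfspace2 /= /dot2 /= mul1r mul0r addr0 => h5.
  have -> : refl2 (1, 0) (1 / 2) x = (1 - x.1, x.2).
    by rewrite /refl2 /dot2 /=; congr pair; field.
  apply/(paraE _ th) => /=.
  have ex : e * x.1 <= e * (1 / 2) by rewrite ler_pM2l.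
  have sx : s * x.2 <= (2 / 5) * e by apply: ler_pM => //; exact: ltW.
  have sx0 : 0 <= s * x.2 by exact: mulr_ge0.
  by split; lra.
have V : vol2 P = e by exact: vol2_para.
have cap_lb : e * (1 - s) / 2 <= cap P (1, 0) (1 / 2).
  have hs : s / e * e = s by rewrite divfK// gt_eqF.
  have -> : e * (1 - s) / 2 = vol2 (trapezoid 0 e 0 (s / e) (1 / 2) 0).
    rewrite vol2_trapezoid//; first by field; rewrite gt_eqF.
      by rewrite !mulr0 !addr0 divr_ge0.
    by rewrite hs mul0r add0r addr0; lra.
  apply: le_vol2.
  - exact: measurable_trapezoid.
  - by apply: measurableI => //; exact: measurable_halfspace2.
  - by apply: bounded2S bP; exact: subIsetl.
  - move=> x [yy /andP[x0 x1]]; have /andP[y0 y1] := yy.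
    rewrite mul0r addr0 in x1; split; last first.
      by rewrite /halfspace2 /= /dot2 /= mul1r mul0r addr0.
    split => //; rewrite x0 /=.
    have : 0 <= s / e * x.2 by rewrite mulr_ge0// divr_ge0.
    by lra.
apply/eqP; rewrite eq_le; apply/andP; split; last first.
  apply: le_trans (sym_fold2_ge mP bP u0 val); rewrite V.
  have -> : 1 - s = 2 / e * (e * (1 - s) / 2) by field; rewrite gt_eqF.
  by rewrite ler_pM2l// divr_gt0.
rewrite /sym_fold2 V.
have -> : 1 - s = 2 / e * (e * (1 - s) / 2) by field; rewrite gt_eqF.
rewrite ler_pM2l ?divr_gt0//; apply: ge_sup.
  by exists (cap P (1, 0) (1 / 2)), (1, 0), (1 / 2).
by move=> _ [a [c [a0 [h ->]]]]; exact: cap_para_fold.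
Qed.

End ThinPara.

Lemma golden_invE (R : realType) : (golden R)^-1 = (Num.sqrt 5 - 1) / 2.
Proof.
have s5 : Num.sqrt 5 * Num.sqrt 5 = 5 :> R by rewrite -expr2 sqr_sqrtr.
have s0 : 0 <= Num.sqrt 5 :> R by exact: sqrtr_ge0.
have g0 : golden R != 0 by rewrite /golden gt_eqF// divr_gt0//; lra.
apply: (mulfI g0); rewrite mulfV// /golden.
by lra.
Qed.

Theorem theorem1p3 (R : realType) :
  (forall K : set (R * R), convex_body2 K -> 3 / 8 <= sym_fold2 K) /\
  (exists P : nat -> set (R * R),
      (forall j, is_parallelogram2 (P j)) /\
      (fun j => sym_fold2 (P j)) @ \oo --> (golden R)^-1) /\
  (3 / 8 <= varphi2 R /\ varphi2 R <= (golden R)^-1) /\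
  (forall K : set (R * R), convex_body2 K -> centrally_symmetric2 K ->
      4 / 9 <= sym_fold2 K) /\
  4 / 9 <= varphi_cs2 R.
Proof.
have s5 : Num.sqrt 5 * Num.sqrt 5 = 5 :> R by rewrite -expr2 sqr_sqrtr.
have s5_ge0 : 0 <= Num.sqrt 5 :> R by exact: sqrtr_ge0.
have s5_gt : 22 / 10 < Num.sqrt 5 :> R by nra.
have s5_lt : Num.sqrt 5 < 23 / 10 :> R by nra.
(* The factor [1 / 20] keeps [s j] above [3 / 10], given [Num.sqrt 5 < 23 / 10]. *)
pose del (j : nat) : R := 1 / 20 * j.+1%:R^-1.
have del0 j : 0 < del j by rewrite /del mulr_gt0// ?divr_gt0// invr_gt0.
have del1 j : del j <= 1 / 20.
  by rewrite /del -[X in _ <= X]mulr1 ler_pM2l ?divr_gt0// invf_le1// ler1n.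
pose s j : R := (3 - Num.sqrt 5) / 2 - del j.
(* Positive, as [s j] is below the smaller root [(3 - Num.sqrt 5) / 2]. With this [e], the last
   condition of [thin_para] becomes [16 e^2 (1 + s - s^2) <= 10 e]. *)
pose e j : R := (1 - 3 * s j + s j ^+ 2) / 10.
have tE j : 1 - 3 * s j + s j ^+ 2 = Num.sqrt 5 * del j + del j ^+ 2.
  by rewrite /s; lra.
have th j : thin_para (s j) (e j).
  have d0 := del0 j; have d1 := del1 j.
  have sj1 : 3 / 10 < s j by rewrite /s; lra.
  have sj2 : s j < 2 / 5 by rewrite /s; lra.
  have e0 : 0 < e j by rewrite /e tE divr_gt0// addr_gt0// ?mulr_gt0// ?exprn_gt0//; lra.
  have te : 1 - 3 * s j + s j ^+ 2 = 10 * e j by rewrite /e; field.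
  have e1 : e j <= 1 / 10 by nra.
  split => //; nra.
have sE j : sym_fold2 (para (s j) (e j)) = (golden R)^-1 + del j.
  by rewrite sym_fold2_para// golden_invE /s; field.
have del_cvg : del @ \oo --> (0 : R).
  rewrite -(mulr0 (1 / 20)); apply: cvgM; first exact: cvg_cst.
  exact: cvg_harmonic.
have cvgP : (fun j => sym_fold2 (para (s j) (e j))) @ \oo --> (golden R)^-1.
  rewrite (_ : (fun j => _) = (fun j => (golden R)^-1 + del j)); last exact/funext.
  by rewrite -[X in _ --> X]addr0; apply: cvgD => //; exact: cvg_cst.
have body j := para_convex_body2 (th j).
have lb : has_lbound [set sym_fold2 K | K in @convex_body2 R].
  by exists (3 / 8) => _ [K bK <-]; exact: sym_fold2_general.
split; first exact: sym_fold2_general.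
split.
  by exists (fun j => para (s j) (e j)); split => // j; exact: para_is_parallelogram2 (th j).
split; first split.
- apply: lb_le_inf; first by exists (sym_fold2 (para (s 0) (e 0))), (para (s 0) (e 0)).
  by move=> _ [K bK <-]; exact: sym_fold2_general.
- apply: (cvgr_to_ge cvgP); near=> j.
  by apply: ge_inf => //; exists (para (s j) (e j)).
split; first exact: sym_fold2_central.
apply: lb_le_inf; last by move=> _ [K [bK cK] <-]; exact: sym_fold2_central.
(* The infimum of an empty set would be [0] by default; the parallelogram, being centrally
   symmetric, shows that the set is not empty. *)
exists (sym_fold2 (para (s 0) (e 0))), (para (s 0) (e 0)) => //; split => //.
exact: para_centrally_symmetric2 (th 0%N).
Unshelve. all: by end_near.
Qed.
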